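(* Let $1<p\le\infty$, $q=p/(p-1)$ (with $q=1$ for $p=\infty$), and consider one of the following two settings. (i) Lattice rules: $N$ is prime, $G=\mathbb{Z}_N=\{0,\dots,N-1\}$, $\Lambda_{\mathfrak u}=\mathbb{Z}_{\mathfrak u}$, and $\varphi_{\boldsymbol h}$ is the Fourier basis. (ii) Polynomial lattice rules: $N=b^m$ with $b$ prime, $P\in\mathbb{F}_b[X]$ is irreducible over $\mathbb{F}_b$ with $\deg P=n$, $G=G_{b,n}$, $\Lambda_{\mathfrak u}=\mathbb{N}_{\mathfrak u}$, and $\varphi_{\boldsymbol h}$ is the Walsh basis in base $b$. Assume that the decay function has the form $r_{\alpha,\boldsymbol\gamma}(\boldsymbol h)=\gamma_{\mathfrak u(\boldsymbol h)}^{-1/2}\,r_\alpha(\boldsymbol h)$ with $$r_\alpha(\boldsymbol h)=\prod_{j\in\mathfrak u(\boldsymbol h)}r_\alpha(h_j),\qquad r_\alpha(|G|\,h)\ge N^\alpha\,r_\alpha(h)\ \text{ for } h\neq0,\qquad \sum_{h\ne0}r_\alpha(h)^{-1}<\infty\ \text{ for all }\alpha>1.$$ Then, for fixed $\lambda$ with $1\le\lambda<\alpha q$, a generating vector $\boldsymbol z^*=(z_1^*,\dots,z_s^* )\in G^s$ can be found component by component, i.e. by choosing successively for $d=1,\dots,s$ the component $z_d^*\in G$ as a minimizer over $z\in G$ of the $d$-dimensional worst-case error $e_d((z_1^*,\dots,z_{d-1}^*,z),N;|||\cdot|||_{p,\alpha,\boldsymbol\gamma})$ with the previous choices $z_1^*,\dots,z_{d-1}^*$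 kept fixed. The worst-case error then satisfies, for each $s$, $$e_s(\boldsymbol z^*,N;|||\cdot|||_{p,\alpha,\boldsymbol\gamma})\le\left(\frac2N\sum_{\emptyset\ne\mathfrak u\subseteq\{1,\dots,s\}}\gamma_{\mathfrak u}^{q/(2\lambda)}\sum_{\boldsymbol h_{\mathfrak u}\in\Lambda_{\mathfrak u}}r_\alpha(\boldsymbol h_{\mathfrak u})^{-q/\lambda}\right)^{\lambda/q}.$$
   Context: Notation: $\mathbb{N}_0=\{0,1,2,\dots\}$; $\mathfrak u(\boldsymbol h)=\{j:h_j\ne0\}$; $\mathbb{Z}_{\mathfrak u}$ (resp. $\mathbb{N}_{\mathfrak u}$) is the set of $\boldsymbol h\in\mathbb{Z}^s$ (resp. $\mathbb{N}_0^s$) with $\mathfrak u(\boldsymbol h)=\mathfrak u$. In setting (i) $\Lambda=\mathbb{Z}^s$, in setting (ii) $\Lambda=\mathbb{N}_0^s$. $G_{b,n}=\{k\in\mathbb{F}_b[X]:\deg k<n\}$, $|G_{b,n}|=b^n$. Weights: $\gamma_{\mathfrak u}\ge0$ for finite $\mathfrak u$; if $\gamma_{\mathfrak u}=0$ then $r_{\alpha,\boldsymbol\gamma}(\boldsymbol h)^{-1}=0$ for $\mathfrak u(\boldsymbol h)=\mathfrak u$ and functions in the space have $\hat f_{\boldsymbol h}=0$ for those $\boldsymbol h$. Decay function: for each admissible smoothness parameter $\alpha>0$ there is a positive function $r_\alpha(h)$ of one integer variable ($h\in\mathbb{Z}$ in (i), $h\in\mathbb{N}_0$ in (ii)); $|G|\,h$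 denotes the integer product. The sum $\sum_{h\neq0}$ is over nonzero $h$ in $\mathbb{Z}$ resp. $\mathbb{N}_0$. Bases: Fourier: $\varphi_{\boldsymbol h}(\boldsymbol x)=e^{2\pi\mathrm i\,\boldsymbol h\cdot\boldsymbol x}$. Walsh: $\varphi_{\boldsymbol h}(\boldsymbol x)=\prod_{j=1}^s\mathrm{wal}_{b,h_j}(x_j)$, where $\mathrm{wal}_{b,h}(x)=e^{2\pi\mathrm i(x_1h_0+x_2h_1+\cdots)/b}$ for base-$b$ expansions $x=\sum_{i\ge1}x_ib^{-i}$ and $h=\sum_{i\ge0}h_ib^i$. Both are products over $j\in\mathfrak u(\boldsymbol h)$ of one-dimensional functions. Points. (i): $\boldsymbol x_k=\frac{\boldsymbol zk\bmod N}{N}$, $k=0,\dots,N-1$. (ii): $k=\sum_{i=0}^{m-1}k_ib^i\in\{0,\dots,b^m-1\}$ is identified with $k(X)=\sum_{i=0}^{m-1}k_iX^i$; if $\frac{z_j(X)k(X)\bmod P(X)}{P(X)}=\sum_{i\ge1}x_{k,j,i}X^{-i}$, then the $j$th coordinate of the $k$th point is $\sum_{i=1}^nx_{k,j,i}b^{-i}$. Here $n=m$, or $n=\alpha m$ with $\alpha\ge1$ an integer (higher-order polynomial lattice rules). Worst-case error in $d$ dimensions (points generated by $\boldsymbol z\in G^d$): $e_d(\boldsymbol z,N;|||\cdot|||_{p,\alpha,\boldsymbol\gamma})=\sup\bigl|\frac1N\sum_{k=0}^{N-1}f(\boldsymbol x_k)-\int_{[0,1)^d}f\bigr|$ over all $f=\sum_{\boldsymbol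 h}\hat f_{\boldsymbol h}\varphi_{\boldsymbol h}$ (absolutely convergent, $\boldsymbol h\in\mathbb{Z}^d$ resp. $\mathbb{N}_0^d$) with $|||f|||_{p,\alpha,\boldsymbol\gamma}\le1$, where $|||f|||^p_{p,\alpha,\boldsymbol\gamma}=\sum_{\boldsymbol h\ne\boldsymbol 0}|\hat f_{\boldsymbol h}|^pr_{\alpha,\boldsymbol\gamma}(\boldsymbol h)^p$ for $p<\infty$ and $|||f|||_{\infty,\alpha,\boldsymbol\gamma}=\sup_{\boldsymbol h\ne\boldsymbol 0}|\hat f_{\boldsymbol h}|\,r_{\alpha,\boldsymbol\gamma}(\boldsymbol h)$. It has the form $$e_d(\boldsymbol z,N;|||\cdot|||_{p,\alpha,\boldsymbol\gamma})=\Bigl(\sum_{\boldsymbol 0\ne\boldsymbol h\in L^\perp}r_{\alpha,\boldsymbol\gamma}(\boldsymbol h)^{-q}\Bigr)^{1/q}=\Bigl(\sum_{\emptyset\ne\mathfrak u\subseteq\{1,\dots,d\}}\gamma_{\mathfrak u}^{q/2}\sum_{\boldsymbol h_{\mathfrak u}\in L^\perp\cap\Lambda_{\mathfrak u}}r_\alpha(\boldsymbol h_{\mathfrak u})^{-q}\Bigr)^{1/q},$$ where the dual $L^\perp$ is the set of $\boldsymbol h$ for which $\frac1N\sum_{k=0}^{N-1}\varphi_{\boldsymbol h}(\boldsymbol x_k)=1$ (this average is $0$ otherwise); in (i) $L^\perp=\{\boldsymbol h:\boldsymbol h\cdot\boldsymbol z\equiv0\pmod N\}$. Worst-case errors and the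 right-hand side of the bound may be $+\infty$. *)

(* Defs.v *)
From HB Require Import structures.
From mathcomp Require Import all_boot all_order all_algebra finmap.
From mathcomp Require Import all_classical all_reals all_analysis.
From mathcomp Require Import qpoly complex.

Set Implicit Arguments.
Unset Strict Implicit.
Unset Printing Implicit Defensive.

Import Order.TTheory GRing.Theory Num.Theory.
Import numFieldNormedType.Exports Normc.

Local Open Scope classical_set_scope.
Local Open Scope ring_scope.

(* The frequency domain is an additive monoid (int or nat), so that the product
   of an integer n and a frequency h is h *+ n.  A rule is given by the
   coordinate in [0, 1) that a component g of the generating vector contributes
   to the k-th point. *)
Record qmc_rule (R : realType) := QmcRule {
  freq : nmodType;
  gen : finType;
  npoints : nat;
  coord : gen -> nat -> R;
  basis : forall d : nat, d.-tuple freq -> d.-tuple R -> R[i] }.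

Section Bases.
Context {R : realType}.

Definition e2pi (t : R) : R[i] := Complex (cos (2 * pi * t)) (sin (2 * pi * t)).

Definition fourier (d : nat) (h : d.-tuple int) (x : d.-tuple R) : R[i] :=
  e2pi (\sum_(j < d) (tnth h j)%:~R * tnth x j).

(* The coefficient of b^-i, i >= 1, in the base b expansion of x >= 0 which has
   infinitely many digits different from b - 1. *)
Definition real_digit (b : nat) (x : R) (i : nat) : nat :=
  (Num.truncn (b%:R ^+ i * x) %% b)%N.

Definition nat_digit (b h i : nat) : nat := ((h %/ b ^ i) %% b)%N.

(* For b > 1 the digits of h of index i >= h vanish, since h < b ^ h. *)
Definition wal (b h : nat) (x : R) : R[i] :=
  e2pi ((\sum_(i < h) real_digit b x i.+1 * nat_digit b h i)%N%:R / b%:R).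

Definition walsh (b d : nat) (h : d.-tuple nat) (x : d.-tuple R) : R[i] :=
  \prod_(j < d) wal b (tnth h j) (tnth x j).

End Bases.

Section Rules.
Variable R : realType.

Definition lattice_rule (N : nat) : qmc_rule R :=
  @QmcRule R int 'I_N N
    (fun z k => ((z * k) %% N)%N%:R / N%:R)
    (@fourier R).

(* Coefficient of X^-i, i >= 1, in the Laurent expansion of a / P in X^-1, where
   deg a < deg P: it is the constant term of the polynomial part of X^i a / P. *)
Definition laurent_digit (F : fieldType) (a P : {poly F}) (i : nat) : F :=
  (('X^i * a) %/ P)`_0.

Definition poly_of_nat (b m k : nat) : {poly 'F_b} :=
  \poly_(i < m) (nat_digit b k i)%:R.

(* {poly_n F} is the type of polynomials of degree < n. *)
Definition polynomial_lattice_rule (b m : nat) (P : {poly 'F_b}) : qmc_rule R :=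
  let n := (size P).-1 in
  @QmcRule R nat {poly_n 'F_b} (b ^ m)%N
    (fun z k =>
       let a := ((z : {poly 'F_b}) * poly_of_nat b m k) %% P in
       \sum_(1 <= i < n.+1) (laurent_digit a P i : nat)%:R * b%:R ^- i)
    (@walsh R b).

(* The parameter alpha only matters for higher-order polynomial lattice rules,
   where deg P = alpha * m. *)
Inductive qmc_setting (alpha : R) : qmc_rule R -> Prop :=
| LatticeSetting (N : nat) :
    prime N -> qmc_setting alpha (lattice_rule N)
| PolynomialLatticeSetting (b m n : nat) (P : {poly 'F_b}) :
    prime b -> irreducible_poly P -> size P = n.+1 ->
    n = m \/ (exists2 a : nat, (1 <= a)%N & alpha = a%:R /\ n = (a * m)%N) ->
    qmc_setting alpha (polynomial_lattice_rule m P).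

End Rules.

Section CubeMeasure.
Variable R : realType.
Local Notation T := (measurableTypeR R).

Definition unit_measure : set T -> \bar R :=
  mrestr (@lebesgue_measure R) (measurable_itv `[0, 1[).

HB.instance Definition _ := Measure.on unit_measure.

Let unit_measure_setT : unit_measure setT = 1%E.
Proof.
by rewrite /unit_measure /mrestr setTI lebesgue_measure_itv/= lte_fin ltr01 sube0.
Qed.

HB.instance Definition _ :=
  Measure_isProbability.Build _ _ _ unit_measure unit_measure_setT.

Definition cons_coord (d : nat) (xy : T * d.-tuple T) : d.+1.-tuple T :=
  [tuple of xy.1 :: xy.2].

Let measurable_cons_coord d : measurable_fun setT (@cons_coord d).
Proof. exact: measurable_cons. Qed.

HB.instance Definition _ d :=
  isMeasurableFun.Build _ _ _ _ (@cons_coord d) (@measurable_cons_coord d).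

(* Lebesgue measure restricted to [0, 1)^d. *)
Fixpoint cube_measure (d : nat) : probability (d.-tuple T) R :=
  if d is d'.+1
  then distribution (unit_measure \x cube_measure d')%E (@cons_coord d')
  else \d_ [tuple].

End CubeMeasure.

Section WorstCaseError.
Variable R : realType.

Definition cube (d : nat) : set (d.-tuple R) :=
  [set x | forall j, 0 <= tnth x j < 1].
Arguments cube d : clear implicits.

Definition cube_integral (d : nat) (f : d.-tuple R -> R[i]) : R[i] :=
  Complex (\int[cube_measure R d]_(x in cube d) complex.Re (f x))
          (\int[cube_measure R d]_(x in cube d) complex.Im (f x)).

Definition has_sum (I : choiceType) (a : I -> R[i]) (l : R[i]) : Prop :=
  forall e : R, 0 < e -> exists A : {fset I}, forall B : {fset I},
    (A `<=` B)%fset -> normc (\sum_(i <- B) a i - l) < e.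

Variable S : qmc_rule R.

(* Coordinates are labelled from 1, as in {1, ..., d}. *)
Definition labels (d : nat) (u : {set 'I_d}) : {fset nat} :=
  [fset (nat_of_ord j).+1 | j in u]%fset.

Definition supp (d : nat) (h : d.-tuple (freq S)) : {set 'I_d} :=
  [set j | tnth h j != 0]%SET.

Definition zero_freq (d : nat) : d.-tuple (freq S) := [tuple 0 | j < d].

Definition decay_prod (r : freq S -> R) (d : nat) (h : d.-tuple (freq S)) : R :=
  \prod_(j in supp h) r (tnth h j).

(* The value +oo when the weight vanishes encodes r_{alpha,gamma}(h)^-1 = 0;
   since 0 * +oo = 0 in \bar R, it also makes every series of finite norm have
   zero coefficient at such an h. *)
Definition decay (gamma : {fset nat} -> R) (r : freq S -> R) (d : nat)
    (h : d.-tuple (freq S)) : \bar R :=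
  let g := gamma (labels (supp h)) in
  if g == 0 then +oo%E else (g `^ (- 2^-1) * decay_prod r h)%:E.

Definition coef_norm (p : \bar R) (gamma : {fset nat} -> R) (r : freq S -> R)
    (d : nat) (c : d.-tuple (freq S) -> R[i]) : \bar R :=
  let term h := ((normc (c h))%:E * decay gamma r h)%E in
  match p with
  | p'%:E => ((\esum_(h in [set h | h != zero_freq d]) term h `^ p') `^ p'^-1)%E
  | _ => ereal_sup [set term h | h in [set h | h != zero_freq d]]
  end.

Definition unit_ball (p : \bar R) (gamma : {fset nat} -> R) (r : freq S -> R)
    (d : nat) (f : d.-tuple R -> R[i]) : Prop :=
  exists c : d.-tuple (freq S) -> R[i],
    [/\ (\esum_(h in setT) (normc (c h))%:E < +oo)%E,
        forall x, x \in cube d -> has_sum (fun h => c h * basis h x) (f x)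
      & (coef_norm p gamma r c <= 1)%E].

Definition qmc_point (d : nat) (z : d.-tuple (gen S)) (k : nat) : d.-tuple R :=
  [tuple coord (tnth z j) k | j < d].

Definition quadrature (d : nat) (z : d.-tuple (gen S)) (f : d.-tuple R -> R[i]) :
    R[i] :=
  (npoints S)%:R^-1 * \sum_(k < npoints S) f (qmc_point z k).

Definition worst_case_error (p : \bar R) (gamma : {fset nat} -> R)
    (r : freq S -> R) (d : nat) (z : d.-tuple (gen S)) : \bar R :=
  ereal_sup [set (normc (quadrature z f - cube_integral f))%:E |
             f in @unit_ball p gamma r d].

(* (z_1, ..., z_d, g), for d <= s; the default of nth is never reached. *)
Definition extend (s : nat) (z : s.-tuple (gen S)) (d : nat) (g : gen S) :
    d.+1.-tuple (gen S) :=
  [tuple of rcons [tuple nth g z i | i < d] g].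

Definition component_by_component (p : \bar R) (gamma : {fset nat} -> R)
    (r : freq S -> R) (s : nat) (z : s.-tuple (gen S)) : Prop :=
  forall (d : 'I_s) (g : gen S),
    (worst_case_error p gamma r (extend z d (tnth z d)) <=
     worst_case_error p gamma r (extend z d g))%E.

Definition conj_exponent (p : \bar R) : R :=
  if p is p'%:E then p' / (p' - 1) else 1.

Definition error_bound (gamma : {fset nat} -> R) (r : freq S -> R)
    (q lambda : R) (s : nat) : \bar R :=
  (((2 / (npoints S)%:R)%:E *
    \sum_(u : {set 'I_s} | u != finset.set0)
      ((gamma (labels u) `^ (q / (2 * lambda)))%:E *
       \esum_(h in [set h : s.-tuple (freq S) | supp h = u])
         (decay_prod r h `^ (- (q / lambda)))%:E))
   `^ (lambda / q))%E.

End WorstCaseError.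

(* Main.v *)
Require Import Defs.
From mathcomp Require Import all_boot all_order all_algebra finmap.
From mathcomp Require Import all_classical all_reals all_analysis.
From mathcomp Require Import measurable_realfun qpoly complex.
From mathcomp Require Import ring lra zify.

(** Both settings are instances of one situation: every basis function is a
    product of one-dimensional functions phi h that behave like characters,
    both along the nodes (for a fixed generating vector) and along the
    generators (for a fixed node).  The record [character_rule] collects what
    the argument uses: the average of a basis function over the nodes is 0 or 1;
    the integral of phi h over [0, 1) vanishes for h <> 0; and, when h is no
    multiple of |G|, summing phi h over all generators gives 0 at every node but
    the first.  All of it comes from [character_sum].  For lattice rules phi h
    is a Fourier function ([lattice_character_rule]); for polynomial lattice
    rules it is a Walsh function, whose value at a node is an additive character
    of F_b[X] / P applied to the numerator ([wal_coord]), and irreducibility of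
    P makes this character non-trivial ([polynomial_character_rule]).

    Let w h be the reciprocal of the decay function.  Integrating and averaging
    an absolutely convergent series termwise, the quadrature error is the sum of
    its coefficients over the non-zero frequencies of the dual, so by duality of
    l^p and l^q the worst-case error is the q-th root of the sum of w h ^ q over
    these frequencies ([worst_case_errorE]).  Equality, not just the upper
    bound, matters: it turns a minimiser of the error in the last generator into
    a minimiser of this dual sum.

    In dimension d + 1, the dual sum splits into the frequencies with last
    component 0, which do not involve the last generator and contribute the dual
    sum in dimension d, and the others.  Take the power 1 / lambda <= 1, which is
    subadditive, and average over the last generator.  A frequency whose last
    component is no multiple of |G| is in the dual for a fraction 1 / N of the
    generators ([count_in_dual]).  Dilating the last component by |G| divides
    w ^ (q / lambda) by at least N, because alpha * q / lambda > 1
    ([coef_weight_dilate]), so the multiples of |G| cost at most as much again,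
    whence the factor 2 / N.  The chosen generator is at least as good as the
    average ([greedy_step]); iterating over the dimensions sums up the
    contributions of all non-zero frequencies ([greedy_bound]), which are
    finally grouped by support. *)

Set Implicit Arguments.
Unset Strict Implicit.
Unset Printing Implicit Defensive.

Import Order.TTheory GRing.Theory Num.Theory.
Import numFieldNormedType.Exports Normc.

Local Open Scope classical_set_scope.
Local Open Scope ring_scope.

(** * Modulus and characters of the circle *)


Section ComplexModulus.
Variable R : realType.
Implicit Types z w : R[i].

Lemma normc_ge0 z : 0 <= normc z.
Proof. by case: z => a b; rewrite /normc sqrtr_ge0. Qed.

Lemma le_normc_add z w : normc (z + w) <= normc z + normc w.
Proof. exact: le_normcD. Qed.

Lemma le_normc_sum (I : Type) (s : seq I) (P : pred I) (F : I -> R[i]) :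
  normc (\sum_(i <- s | P i) F i) <= \sum_(i <- s | P i) normc (F i).
Proof.
elim/big_rec2: _ => [|i y1 y2 _ IH]; first by rewrite normc0.
by apply: le_trans (le_normc_add _ _) _; rewrite lerD2l.
Qed.

Lemma normc_prod (I : Type) (s : seq I) (P : pred I) (F : I -> R[i]) :
  normc (\prod_(i <- s | P i) F i) = \prod_(i <- s | P i) normc (F i).
Proof. by elim/big_rec2: _ => [|i y1 y2 _ <-]; rewrite ?normc1 ?normcM. Qed.

Lemma normc_real (a : R) : 0 <= a -> normc (a%:C)%C = a.
Proof. by move=> a0; rewrite /= expr0n /= addr0 sqrtr_sqr ger0_norm. Qed.

Lemma normc_nat n : normc (n%:R : R[i]) = n%:R.
Proof. by rewrite -(rmorph_nat (@real_complex R)) normc_real. Qed.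

Lemma le_Re_normc z : `|complex.Re z| <= normc z.
Proof.
case: z => a b /=; rewrite -(sqrtr_sqr a) ler_sqrt ?addr_ge0 ?sqr_ge0//.
by rewrite lerDl sqr_ge0.
Qed.

Lemma le_Im_normc z : `|complex.Im z| <= normc z.
Proof.
case: z => a b /=; rewrite -(sqrtr_sqr b) ler_sqrt ?addr_ge0 ?sqr_ge0//.
by rewrite lerDr sqr_ge0.
Qed.

Lemma normc_le_ReIm (a b : R) : normc (Complex a b) <= `|a| + `|b|.
Proof.
rewrite /= -[leRHS]ger0_norm ?addr_ge0// -sqrtr_sqr ler_sqrt ?sqr_ge0//.
rewrite sqrrD !real_normK ?num_real// addrAC lerDl.
by rewrite mulrn_wge0// mulr_ge0.
Qed.

Lemma Re_mul (z w : R[i]) :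
  complex.Re (z * w) = complex.Re z * complex.Re w - complex.Im z * complex.Im w.
Proof. by case: z w => [a b] [c d]. Qed.

Lemma Im_mul (z w : R[i]) :
  complex.Im (z * w) = complex.Re z * complex.Im w + complex.Im z * complex.Re w.
Proof. by case: z w => [a b] [c d]. Qed.

Lemma Re_add (z w : R[i]) : complex.Re (z + w) = complex.Re z + complex.Re w.
Proof. by case: z w => [a b] [c d]. Qed.

Lemma Im_add (z w : R[i]) : complex.Im (z + w) = complex.Im z + complex.Im w.
Proof. by case: z w => [a b] [c d]. Qed.

Lemma Re_sub (z w : R[i]) : complex.Re (z - w) = complex.Re z - complex.Re w.
Proof. by case: z w => [a b] [c d]. Qed.

Lemma Im_sub (z w : R[i]) : complex.Im (z - w) = complex.Im z - complex.Im w.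
Proof. by case: z w => [a b] [c d]. Qed.

Lemma Re_sum (I : Type) (s : seq I) (P : pred I) (F : I -> R[i]) :
  complex.Re (\sum_(i <- s | P i) F i) = \sum_(i <- s | P i) complex.Re (F i).
Proof. by apply: (big_morph (@complex.Re R)) => // -[a b] [c d]. Qed.

Lemma Im_sum (I : Type) (s : seq I) (P : pred I) (F : I -> R[i]) :
  complex.Im (\sum_(i <- s | P i) F i) = \sum_(i <- s | P i) complex.Im (F i).
Proof. by apply: (big_morph (@complex.Im R)) => // -[a b] [c d]. Qed.

End ComplexModulus.

(** The source of all orthogonality relations: multiplying the sum by the value
    chi a only permutes its terms. *)
Lemma character_sum (F : fieldType) (K : finType) (op : K -> K -> K)
    (chi : K -> F) (a : K) :
  injective (op a) -> (forall k, chi (op a k) = chi a * chi k) -> chi a != 1 ->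
  \sum_k chi k = 0.
Proof.
move=> inj hom nt.
have : \sum_k chi k = chi a * \sum_k chi k.
  rewrite mulr_sumr (reindex (op a)) /=; first by apply: eq_bigr => k _.
  exact/onW_bij/injF_bij.
move/eqP; rewrite -subr_eq0 -{1}[\sum_k _]mul1r -mulrBl mulf_eq0 subr_eq0.
by rewrite eq_sym (negPf nt) => /eqP.
Qed.

Section CircleCharacter.
Variable R : realType.
Implicit Types s t : R.

Lemma e2pi0 : e2pi (0 : R) = 1.
Proof. by rewrite /e2pi mulr0 cos0 sin0. Qed.

Lemma e2piD s t : e2pi (s + t) = e2pi s * e2pi t.
Proof.
rewrite /e2pi mulrDr cosD sinD; congr Complex.
by rewrite addrC [sin _ * cos _]mulrC [X in _ + X]mulrC addrC.
Qed.

Lemma e2pi_sum (I : Type) (r : seq I) (P : pred I) (F : I -> R) :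
  e2pi (\sum_(i <- r | P i) F i) = \prod_(i <- r | P i) e2pi (F i).
Proof. exact: (big_morph _ e2piD e2pi0). Qed.

Lemma normc_e2pi t : normc (e2pi t) = 1.
Proof. by rewrite /normc /e2pi cos2Dsin2 sqrtr1. Qed.

Lemma e2pi_neq0 t : e2pi t != 0.
Proof.
apply/eqP => e0; have := normc_e2pi t.
by rewrite e0 normc0 => /eqP; rewrite eq_sym oner_eq0.
Qed.

Lemma e2pi_nat (n : nat) : e2pi (n%:R : R) = 1.
Proof.
elim: n => [|n IH]; first exact: e2pi0.
rewrite -addn1 natrD e2piD IH mul1r /e2pi mulr1 mulr_natl.
by rewrite cos2pi sin2pi.
Qed.

Lemma e2pi_int (n : int) : e2pi (n%:~R : R) = 1.
Proof.
case: n => n; first exact: e2pi_nat.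
apply: (mulfI (e2pi_neq0 n.+1%:R)).
by rewrite -e2piD NegzE rmorphN /= subrr e2pi0 e2pi_nat mulr1.
Qed.

Lemma e2piDint t (n : int) : e2pi (t + n%:~R) = e2pi t.
Proof. by rewrite e2piD e2pi_int mulr1. Qed.

Lemma e2pi_neq1 t : 0 < t < 1 -> e2pi t != 1.
Proof.
move=> /andP[t0 t1]; apply/eqP; rewrite /e2pi => -[] + _.
have -> : 2 * pi * t = (pi * t) *+ 2 by rewrite -mulrA mulr_natl.
rewrite cos_mulr2n cos2sin2 => h.
have : 0 < sin (pi * t).
  by apply: sin_gt0_pi; rewrite mulr_gt0 ?pi_gt0//= gtr_pMr// pi_gt0.
rewrite lt_neqAle eq_sym => /andP[/negP n0 _]; apply: n0.
by rewrite -sqrf_eq0; apply/eqP; rewrite mulr2n in h; lra.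
Qed.

Definition zeta (b a : nat) : R[i] := e2pi (a%:R / b%:R).

Lemma zetaD b x y : zeta b (x + y) = zeta b x * zeta b y.
Proof. by rewrite /zeta natrD mulrDl e2piD. Qed.

Lemma zeta0 b : zeta b 0 = 1.
Proof. by rewrite /zeta mul0r e2pi0. Qed.

Lemma zeta_modn b x : (0 < b)%N -> zeta b (x %% b) = zeta b x.
Proof.
move=> b0; rewrite {2}(divn_eq x b) zetaD /zeta natrM mulfK ?e2pi_nat ?mul1r//.
by rewrite pnatr_eq0 -lt0n.
Qed.

Lemma zeta_neq1 b x : (0 < b)%N -> ~~ (b %| x)%N -> zeta b x != 1.
Proof.
move=> b0 bx; rewrite -zeta_modn//; apply: e2pi_neq1.
by rewrite divr_gt0 ?ltr0n// ?lt0n//= ltr_pdivrMr ?ltr0n// mul1r ltr_nat ltn_mod.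
Qed.

Lemma measurable_Re_e2pi (c : R) :
  measurable_fun setT (fun x : R => complex.Re (e2pi (c * x))).
Proof.
apply: (measurableT_comp (f := @cos R)).
  apply: continuous_measurable_fun; exact: continuous_cos.
by apply: measurable_funM => //; apply: measurable_funM.
Qed.

Lemma measurable_Im_e2pi (c : R) :
  measurable_fun setT (fun x : R => complex.Im (e2pi (c * x))).
Proof.
apply: (measurableT_comp (f := @sin R)).
  apply: continuous_measurable_fun; exact: continuous_sin.
by apply: measurable_funM => //; apply: measurable_funM.
Qed.

End CircleCharacter.

(** * Rules built from characters; lattice rules *)


(** The features shared by lattice and polynomial lattice rules.  Measurability
    and integrals are only asked on [0, 1), where the Walsh functions are step
    functions.  In the last field, l *+ #|gen S| runs over the frequencies whose
    values at the nodes do not depend on the generator. *)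
Record character_rule (R : realType) (S : qmc_rule R)
    (phi : freq S -> R -> R[i]) : Prop := CharacterRule {
  basis_prod : forall d (h : d.-tuple (freq S)) (x : d.-tuple R),
    Defs.basis h x = \prod_(j < d) phi (tnth h j) (tnth x j);
  phi0 : forall x, phi 0 x = 1;
  normc_phi : forall h x, normc (phi h x) = 1;
  measurable_Re_phi : forall h,
    measurable_fun (`[0, 1[ : set R) (fun x : R => complex.Re (phi h x));
  measurable_Im_phi : forall h,
    measurable_fun (`[0, 1[ : set R) (fun x : R => complex.Im (phi h x));
  integral_Re_phi : forall h : freq S, h != 0 ->
    \int[@unit_measure R]_(x in `[0, 1[) complex.Re (phi h x) = 0;
  integral_Im_phi : forall h : freq S, h != 0 ->
    \int[@unit_measure R]_(x in `[0, 1[) complex.Im (phi h x) = 0;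
  npoints_gt0 : (0 < npoints S)%N;
  card_gen_gt0 : (0 < #|gen S|)%N;
  coord_itv : forall (g : gen S) k, 0 <= Defs.coord g k < 1;
  mul_card_gen_inj : injective (fun h : freq S => h *+ #|gen S|);
  average_01 : forall d (z : d.-tuple (gen S)) (h : d.-tuple (freq S)),
    let a := (npoints S)%:R^-1 *
      \sum_(k < npoints S) \prod_(j < d) phi (tnth h j) (Defs.coord (tnth z j) k) in
    a = 0 \/ a = 1;
  gen_sum : forall h k, (k < npoints S)%N ->
    (forall l, h <> l *+ #|gen S|) ->
    \sum_(g : gen S) phi h (Defs.coord g k) = if k == 0%N then #|gen S|%:R else 0 }.

Section UnitInterval.
Variable R : realType.
Local Notation mu := (@unit_measure R).

(** On [0, 1) the fundamental theorem of calculus and the measures of intervals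
    are those of the Lebesgue measure. *)
Lemma Rintegral_unit_measure (f : R -> R) :
  \int[mu]_(x in `[0, 1[) f x = \int[@lebesgue_measure R]_(x in `[0, 1[) f x.
Proof.
rewrite /Rintegral; congr fine.
apply: (@eq_measure_integral _ _ R _ (@lebesgue_measure R) mu) => A mA sA /=.
by rewrite /unit_measure /mrestr setIidl.
Qed.

Lemma integral_of_derivative (f F : R -> R) : continuous f ->
  (forall x : R, is_derive x (1 : R) F (f x)) -> F 0 = F 1 ->
  \int[mu]_(x in `[0, 1[) f x = 0.
Proof.
move=> cf dF F01; rewrite Rintegral_unit_measure Rintegral_itv_bndo_bndc.
  rewrite /Rintegral (@continuous_FTC2 _ _ F)//.
  - by rewrite F01 subee.
  - by apply: continuous_in_subspaceT => x _; exact: cf.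
  - have cF x : {for x, continuous F}.
      by apply: differentiable_continuous; apply/derivable1_diffP; case: (dF x).
    split => [x _||]; first by case: (dF x).
    + by apply: cvg_at_right_filter; exact: cF.
    + by apply: cvg_at_left_filter; exact: cF.
  - by move=> x _; rewrite derive1E; case: (dF x).
have int01 : (@lebesgue_measure R).-integrable `[0, 1] (EFin \o f).
  apply: continuous_compact_integrable; first exact: segment_compact.
  by apply: continuous_in_subspaceT => x _; exact: cf.
apply: integrableS int01 => //.
by apply: subset_itvl; rewrite bnd_simp.
Qed.

Lemma integral_Re_e2pi (c : int) : c != 0 ->
  \int[mu]_(x in `[0, 1[) complex.Re (e2pi (c%:~R * x)) = 0.
Proof.
move=> c0; pose w : R := 2 * pi * c%:~R.
have w0 : w != 0 by rewrite !mulf_neq0 ?intr_eq0// gt_eqF ?pi_gt0.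
apply: (@integral_of_derivative _ (fun x => w^-1 * sin (w * x))) => [x|x|].
- rewrite /e2pi /=; apply: continuous_comp; last exact: continuous_cos.
  apply: cvgM; first exact: cvg_cst.
  by apply: cvgM; [exact: cvg_cst|exact: cvg_id].
- apply: is_derive_eq; rewrite /GRing.scale /= mulr1.
  by rewrite mulrCA mulVf// mulr1 /e2pi /= mulrA.
- have := e2pi_int R c; rewrite /e2pi => -[_].
  by rewrite mulr0 sin0 mulr1 -/w => ->.
Qed.

Lemma integral_Im_e2pi (c : int) : c != 0 ->
  \int[mu]_(x in `[0, 1[) complex.Im (e2pi (c%:~R * x)) = 0.
Proof.
move=> c0; pose w : R := 2 * pi * c%:~R.
have w0 : w != 0 by rewrite !mulf_neq0 ?intr_eq0// gt_eqF ?pi_gt0.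
apply: (@integral_of_derivative _ (fun x => - (w^-1 * cos (w * x)))) => [x|x|].
- rewrite /e2pi /=; apply: continuous_comp; last exact: continuous_sin.
  apply: cvgM; first exact: cvg_cst.
  by apply: cvgM; [exact: cvg_cst|exact: cvg_id].
- apply: is_derive_eq; rewrite /GRing.scale /= mulr1.
  by rewrite mulNr mulrN opprK mulrCA mulVf// mulr1 /w mulrA.
- have := e2pi_int R c; rewrite /e2pi => -[+ _].
  by rewrite mulr0 cos0 mulr1 -/w => ->.
Qed.

End UnitInterval.

Section LatticeRule.
Variables (R : realType) (N : nat).
Hypothesis prN : prime N.

Let N0 : (0 < N)%N. Proof. exact: prime_gt0. Qed.

Definition fourier1 (h : int) (x : R) : R[i] := e2pi (h%:~R * x).

(** Reducing modulo N changes the argument by an integer, so the reduction in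
    the definition of the nodes is invisible to integer frequencies. *)
Lemma fourier1_modn (h : int) (c : nat) :
  fourier1 h ((c %% N)%N%:R / N%:R) = fourier1 h (c%:R / N%:R).
Proof.
rewrite /fourier1 [in RHS](divn_eq c N) natrD natrM mulrDl mulfK; last first.
  by rewrite pnatr_eq0 -lt0n.
rewrite mulrDr addrC -[X in _ = e2pi (_ + X)](_ : (h * (c %/ N)%N%:Z)%:~R = _).
  by rewrite e2piDint.
by rewrite intrM.
Qed.

Lemma fourier1D (h : int) x y : fourier1 h (x + y) = fourier1 h x * fourier1 h y.
Proof. by rewrite /fourier1 mulrDr e2piD. Qed.

Lemma fourier1_neq1 (h : int) (c : nat) : ~~ (N %| `|h|)%N -> ~~ (N %| c)%N ->
  fourier1 h (c%:R / N%:R) != 1.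
Proof.
move=> hN cN; rewrite /fourier1 mulrA.
have -> : h%:~R * c%:R = (h * c%:Z)%:~R :> R by rewrite intrM.
rewrite [h * _](divz_eq _ N) intrD intrM mulrDl mulfK; last first.
  by rewrite pnatr_eq0 -lt0n.
rewrite addrC e2piDint.
have: ((h * c%:Z) %% N)%Z != 0.
  apply: contra hN => /eqP/dvdz_mod0P.
  by rewrite dvdzE abszM Euclid_dvdM//= (negPf cN) orbF.
have: 0 <= ((h * c%:Z) %% N)%Z by rewrite modz_ge0// eqz_nat -lt0n.
have: ((h * c%:Z) %% N)%Z < N by rewrite ltz_pmod// ltz_nat.
case: ((h * c%:Z) %% N)%Z => // a; rewrite ltz_nat eqz_nat => aN _ a0.
apply: zeta_neq1 => //; apply/negP => /dvdn_leq; rewrite lt0n => /(_ a0).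
by rewrite leqNgt aN.
Qed.

Let op (a z : 'I_N) : 'I_N := Ordinal (ltn_pmod (a + z)%N N0).

Let op_inj a : injective (op a).
Proof.
move=> z y [] /eqP; rewrite eqn_modDl !modn_small// => /eqP; exact: val_inj.
Qed.

Lemma lattice_character_rule : character_rule (S := lattice_rule R N) fourier1.
Proof.
split.
- by move=> d h x; rewrite /= /fourier e2pi_sum.
- by move=> x; rewrite /fourier1 mul0r e2pi0.
- by move=> h x; exact: normc_e2pi.
- by move=> h; apply: measurable_funTS; exact: measurable_Re_e2pi.
- by move=> h; apply: measurable_funTS; exact: measurable_Im_e2pi.
- by move=> h /integral_Re_e2pi.
- by move=> h /integral_Im_e2pi.
- exact: N0.
- by rewrite card_ord.
- move=> g k /=; rewrite divr_ge0//= ltr_pdivrMr ?ltr0n// mul1r ltr_nat.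
  exact: ltn_pmod.
- move=> h l /= /eqP; rewrite card_ord -subr_eq0 -mulrnBl mulrn_eq0.
  by rewrite (gtn_eqF N0) /= subr_eq0 => /eqP.
- move=> d z h.
  pose chi (k : 'I_N) : R[i] :=
    \prod_(j < d) fourier1 (tnth h j) (((tnth z j * k) %% N)%N%:R / N%:R).
  have chiD a k : chi (op a k) = chi a * chi k.
    rewrite /chi -big_split /=; apply: eq_bigr => j _.
    by rewrite !fourier1_modn -fourier1D -mulrDl -natrD -mulnDr
      -[RHS]fourier1_modn -modnMmr fourier1_modn.
  have [/forallP chi1|/forallPn[a chia]] := boolP [forall a, chi a == 1];
    [right|left].
    rewrite (eq_bigr (fun=> 1)); last by move=> k _; exact/eqP/chi1.
    by rewrite sumr_const card_ord mulVf// pnatr_eq0 -lt0n.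

  by rewrite (character_sum (@op_inj a) (chiD a) chia) mulr0.
- move=> h k kN hN; have [->|k0] := eqVneq k 0%N.
    rewrite (eq_bigr (fun=> 1)) ?sumr_const ?cardT// => g _.
    by rewrite /= muln0 mod0n mul0r /fourier1 mulr0 e2pi0.
  have N1 : (1 < N)%N by exact: prime_gt1.
  apply: (character_sum (@op_inj (Ordinal N1))) => [g|] /=.
    by rewrite !fourier1_modn -fourier1D -mulrDl -natrD -mulnDl
      -[RHS]fourier1_modn -modnMml fourier1_modn.
  rewrite mul1n fourier1_modn; apply: fourier1_neq1.
    apply/negP => /dvdnP[c hc]; apply: (hN (sgz h * c%:Z)).
    by rewrite card_ord {1}[h]intEsg hc PoszM mulrA -mulr_natr natz.
  by apply/negP => /dvdn_leq; rewrite lt0n k0 leqNgt kN => /(_ isT).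
Qed.

End LatticeRule.

(** * Digit expansions and Walsh functions *)


Section Digits.
Variable b : nat.
Hypothesis b0 : (0 < b)%N.

Lemma ltn_nat_digit a i : (nat_digit b a i < b)%N.
Proof. exact: ltn_pmod. Qed.

Lemma nat_digit_small a i : (a < b ^ i)%N -> nat_digit b a i = 0%N.
Proof. by move=> h; rewrite /nat_digit divn_small// mod0n. Qed.

Lemma digit_sum_lt n (e : nat -> nat) : (forall j, (e j < b)%N) ->
  (\sum_(j < n) e j * b ^ j < b ^ n)%N.
Proof.
elim: n e => [|n IH] e eb; first by rewrite big_ord0.
rewrite big_ord_recr /= expnS.
apply: (@leq_trans ((e n).+1 * b ^ n)%N); last by rewrite leq_mul2r eb orbT.
by rewrite mulSn -addSn leq_add2r IH.
Qed.

Lemma nat_digit_sum n (e : nat -> nat) i : (forall j, (e j < b)%N) -> (i < n)%N ->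
  nat_digit b (\sum_(j < n) e j * b ^ j) i = e i.
Proof.
elim: n e i => // n IH e i eb lt_in.
have -> : (\sum_(j < n.+1) e j * b ^ j =
    (\sum_(j < n) e j.+1 * b ^ j) * b + e 0)%N.
  rewrite big_ord_recl /= muln1 addnC big_distrl /=; congr addn.
  by apply: eq_bigr => j _; rewrite expnSr mulnA.
case: i lt_in => [|i] lt_in.
  by rewrite /nat_digit expn0 divn1 modnMDl modn_small.
rewrite /nat_digit expnS divnMA divnMDl// [(e 0 %/ b)%N]divn_small// addn0.
exact: (IH (fun j => e j.+1)).
Qed.

Lemma nat_digit_inj n x y : (x < b ^ n)%N -> (y < b ^ n)%N ->
  (forall i, (i < n)%N -> nat_digit b x i = nat_digit b y i) -> x = y.
Proof.
elim: n x y => [|n IH] x y.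
  by rewrite expn0 !ltnS !leqn0 => /eqP -> /eqP ->.
move=> xn yn xy; rewrite (divn_eq x b) (divn_eq y b).
have -> : (x %% b = y %% b)%N.
  by have := xy 0%N isT; rewrite /nat_digit expn0 !divn1.
congr (_ * _ + _)%N; apply: IH => [||i lt_in].
- by rewrite ltn_divLR// -expnSr.
- by rewrite ltn_divLR// -expnSr.
- by have := xy i.+1 lt_in; rewrite /nat_digit expnS !divnMA.
Qed.

Lemma nat_digits_eq0 n x : (forall i, (i < n)%N -> nat_digit b x i = 0%N) ->
  (b ^ n %| x)%N.
Proof.
move=> x0; rewrite /dvdn; apply/eqP; apply: (@nat_digit_inj n).
- by rewrite ltn_pmod// expn_gt0 b0.
- by rewrite expn_gt0 b0.
- move=> i lt_in.
  rewrite [RHS]/nat_digit div0n mod0n -[RHS](x0 i lt_in) /nat_digit.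
  have -> : (b ^ n = b ^ (n - i.+1) * b * b ^ i)%N.
    by rewrite -mulnA -expnS -expnD subnK.
  rewrite [in RHS](divn_eq x (b ^ (n - i.+1) * b * b ^ i)).
  by rewrite mulnA divnMDl ?expn_gt0 ?b0// mulnA modnMDl.
Qed.

Lemma big_ord_trunc m n (F : nat -> nat) : (forall i, (n <= i)%N -> F i = 0%N) ->
  (n <= m)%N -> (\sum_(i < m) F i = \sum_(i < n) F i)%N.
Proof.
move=> F0 nm; rewrite (big_ord_widen m F nm) [RHS]big_mkcond.
by apply: eq_bigr => i _; case: ltnP => // /F0.
Qed.

Variable R : realType.

Lemma truncn_divn (y : R) c : (0 < c)%N -> 0 <= y ->
  Num.truncn (y / c%:R) = (Num.truncn y %/ c)%N.
Proof.
move=> c0 y0; have /andP[ty yt] := truncn_itv y0.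
apply: truncn_def; rewrite ler_pdivlMr ?ltr0n// ltr_pdivrMr ?ltr0n//.
rewrite -!natrM (le_trans _ ty) ?ler_nat ?leq_divM//=.
by apply: (lt_le_trans yt); rewrite ler_nat -ltn_divLR.
Qed.

Lemma real_digitE (x : R) n i : 0 <= x -> (i < n)%N ->
  real_digit b x i.+1 = nat_digit b (Num.truncn (b%:R ^+ n * x)) (n - i.+1).
Proof.
move=> x0 lt_in; rewrite /real_digit /nat_digit -truncn_divn ?expn_gt0 ?b0//.
  congr (Num.truncn _ %% _)%N.
  have -> : b%:R ^+ n = b%:R ^+ (n - i.+1) * b%:R ^+ i.+1 :> R.
    by rewrite -exprD subnK.
  by rewrite natrX; field; rewrite expf_neq0// pnatr_eq0 -lt0n.
by rewrite mulr_ge0// exprn_ge0.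
Qed.

Lemma real_digit_oversize (A n i : nat) : (n <= i)%N ->
  real_digit b (A%:R / b%:R ^+ n : R) i.+1 = 0%N.
Proof.
move=> le_ni; rewrite /real_digit.
have -> : b%:R ^+ i.+1 * (A%:R / b%:R ^+ n) = (b ^ (i - n) * A * b)%N%:R :> R.
  rewrite -{1}(subnK le_ni) -addSn exprD exprS !natrM natrX.
  by field; rewrite expf_neq0// pnatr_eq0 -lt0n.
by rewrite natrK modnMl.
Qed.

(** Only the first n digits of x matter, and they are the base b digits of the
    integer part of b^n x read backwards. *)
Lemma wal_trunc (h n : nat) (x : R) : 0 <= x ->
  (forall i, (n <= i)%N -> (real_digit b x i.+1 * nat_digit b h i = 0)%N) ->
  wal b h x = zeta R b
    (\sum_(i < n) nat_digit b (Num.truncn (b%:R ^+ n * x)) (n - i.+1)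
                  * nat_digit b h i).
Proof.
move=> x0 hi; rewrite /wal -/(zeta R b _); congr zeta.
pose F i := (real_digit b x i.+1 * nat_digit b h i)%N.
(* The bound h < b ^ h needs b > 1; for b = 1 all digits vanish. *)
have [b1|b1] := leqP b 1.
  have nd0 a i : nat_digit b a i = 0%N by have := ltn_nat_digit a i; lia.
  by rewrite !big1// => i _; rewrite !nd0 muln0.
transitivity (\sum_(i < n + h) F i)%N.
  symmetry; apply: big_ord_trunc; last exact: leq_addl.
  move=> i hi'; rewrite /F nat_digit_small ?muln0//.
  by apply: leq_ltn_trans hi' _; exact: ltn_expl.
transitivity (\sum_(i < n) F i)%N.
  by apply: big_ord_trunc; last exact: leq_addr.
by apply: eq_bigr => i _; rewrite /F (@real_digitE _ n).
Qed.

Lemma wal_small (h n : nat) (x : R) : 0 <= x -> (h < b ^ n)%N ->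
  wal b h x = zeta R b
    (\sum_(i < n) nat_digit b (Num.truncn (b%:R ^+ n * x)) (n - i.+1)
                  * nat_digit b h i).
Proof.
move=> x0 hn; apply: wal_trunc => // i le_ni; rewrite nat_digit_small ?muln0//.
by apply: leq_trans hn _; rewrite leq_pexp2l.
Qed.

(** Multiplying by b^n reverses the order of the digits. *)
Lemma radix_fraction n (e : nat -> nat) :
  \sum_(1 <= i < n.+1) (e i)%:R * b%:R ^- i =
  (\sum_(j < n) e (n - j) * b ^ j)%N%:R / b%:R ^+ n :> R.
Proof.
have bn0 : b%:R != 0 :> R by rewrite pnatr_eq0 -lt0n.
rewrite big_add1 /= big_nat_rev /= add0n big_mkord natr_sum mulr_suml.
apply: eq_bigr => i _; rewrite natrM natrX subnSK// -mulrA; congr (_ * _).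
have -> : b%:R ^+ n = b%:R ^+ (n - i) * b%:R ^+ i :> R.
  by rewrite -exprD subnK// ltnW.
by rewrite invfM mulrCA mulfV ?mulr1// expf_neq0.
Qed.

Lemma radix_fraction_itv n (e : nat -> nat) : (forall i, (e i < b)%N) ->
  0 <= (\sum_(1 <= i < n.+1) (e i)%:R * b%:R ^- i : R) < 1.
Proof.
move=> eb; rewrite radix_fraction divr_ge0 ?exprn_ge0//=.
rewrite ltr_pdivrMr ?exprn_gt0 ?ltr0n// mul1r -natrX ltr_nat.
exact: (@digit_sum_lt n (fun j => e (n - j)%N)).
Qed.

Lemma wal_finite_digits (h n : nat) (e : nat -> nat) : (forall i, (e i < b)%N) ->
  wal b h (\sum_(1 <= i < n.+1) (e i)%:R * b%:R ^- i : R) =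
  zeta R b (\sum_(i < n) e i.+1 * nat_digit b h i).
Proof.
move=> eb; rewrite radix_fraction (@wal_trunc _ n).
- rewrite mulrCA mulfV ?mulr1; last by rewrite expf_neq0// pnatr_eq0 -lt0n.
  rewrite natrK; congr zeta.
  apply: eq_bigr => i _; congr muln; have lt_in := ltn_ord i.
  by rewrite (@nat_digit_sum _ (fun j => e (n - j)%N))// ?subKn//; lia.
- by rewrite divr_ge0// exprn_ge0.
- by move=> i le_ni; rewrite real_digit_oversize.
Qed.

End Digits.

(** * Polynomial lattice rules *)


Section StepFunctions.
Variables (R : realType) (M : nat) (c : nat -> R) (f : R -> R).
Hypotheses (M0 : (0 < M)%N)
  (fE : forall x, 0 <= x < 1 -> f x = c (Num.truncn (M%:R * x))).

Let cell (a : nat) : set R := `[a%:R / M%:R, a.+1%:R / M%:R[.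

Let step_sum (x : R) : 0 <= x < 1 -> f x = \sum_(a < M) c a * \1_(cell a) x.
Proof.
move=> x01; rewrite fE//; case/andP: x01 => x0 x1.
have Mx0 : 0 <= M%:R * x by rewrite mulr_ge0.
have tM : (Num.truncn (M%:R * x) < M)%N.
  by rewrite truncn_lt_nat// gtr_pMr// ltr0n.
(* The cell containing x is the one with number floor (M x). *)
have indE (a : 'I_M) : \1_(cell a) x = (a == Ordinal tM)%:R :> R.
  rewrite indicE; congr (_%:R); congr nat_of_bool.
  apply/idP/eqP => [|->]; rewrite inE /cell /= in_itv /=.
    rewrite ler_pdivrMr ?ltr0n// ltr_pdivlMr ?ltr0n// [x * _]mulrC => ax.
    by apply/val_inj; rewrite /= (truncn_def ax).
  by rewrite ler_pdivrMr ?ltr0n// ltr_pdivlMr ?ltr0n// [x * _]mulrC truncn_itv.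
rewrite (eq_bigr (fun a : 'I_M => c a * (a == Ordinal tM)%:R)); last first.
  by move=> a _; rewrite indE.
rewrite (bigD1 (Ordinal tM))//= eqxx mulr1 big1 ?addr0// => a /negPf ->.
by rewrite mulr0.
Qed.

Lemma measurable_step : measurable_fun (`[0, 1[ : set R) f.
Proof.
apply: (@eq_measurable_fun _ _ _ _ _ (fun x => \sum_(a < M) c a * \1_(cell a) x)).
  by move=> x; rewrite inE /= in_itv /= => x01; rewrite (step_sum x01).
apply: (@measurable_sum _ (measurableTypeR R) R _ 'I_M _
  (fun a x => c a * \1_(cell a) x)) => a; apply: measurable_funM => //.
by apply: measurable_funTS; apply: measurable_indic; exact: measurable_itv.
Qed.

Lemma integral_step :
  \int[@unit_measure R]_(x in `[0, 1[) f x = M%:R^-1 * \sum_(a < M) c a.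
Proof.
rewrite Rintegral_unit_measure mulr_sumr /Rintegral.
under eq_integral => x do
  (rewrite inE /= in_itv /= => x01; rewrite (step_sum x01) -sumEFin).
have intcell a : (@lebesgue_measure R).-integrable `[0, 1[
    (fun x => (\1_(cell a) x)%:E).
  apply: (@integrableS _ _ _ _ setT) => //.
  exact: integrable_indic_itv.
have intc (a : 'I_M) : (@lebesgue_measure R).-integrable `[0, 1[
    (fun x => (c a * \1_(cell a) x)%:E).
  exact: (integrableZl _ (c a) (intcell a)).
rewrite integral_sum// -sum_fine => [|a _]; last exact: integrable_fin_num.
apply: eq_bigr => a _.
have -> : (\int[@lebesgue_measure R]_(x in `[0%R, 1%R[) (c a * \1_(cell a) x)%:E =
    (c a)%:E * \int[@lebesgue_measure R]_(x in `[0%R, 1%R[) (\1_(cell a) x)%:E)%E.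
  exact: (integralZl _ (intcell a)).
rewrite integral_indic//; last exact: measurable_itv.
rewrite setIidl => [|x].
  rewrite /cell /= lebesgue_measure_itv /= lte_fin ltr_pM2r ?invr_gt0 ?ltr0n//.
  by rewrite ltr_nat ltnSn -EFinD -EFinM /= -mulrBl -natrB// subSnn mul1r mulrC.
rewrite /cell /= !in_itv /= => /andP[ax xa]; rewrite (le_trans _ ax) ?divr_ge0//=.
by apply: (lt_le_trans xa); rewrite ler_pdivrMr ?ltr0n// mul1r ler_nat.
Qed.

End StepFunctions.

Section PolynomialRule.
Variables (R : realType) (b : nat).
Hypothesis prb : prime b.

Let b0 : (0 < b)%N. Proof. exact: prime_gt0. Qed.
Local Notation F := 'F_b.

Lemma val_Fp_add (x y : F) : (x + y : F) = ((x + y) %% b)%N :> nat.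
Proof. by rewrite /=; congr (_ %% _)%N; exact: Fp_cast. Qed.

Lemma ltn_Fp (x : F) : (x < b)%N.
Proof. by apply: leq_trans (ltn_ord x) _; rewrite Fp_cast. Qed.

Lemma zeta_sum (I : Type) (r : seq I) (P : pred I) (E : I -> nat) :
  zeta R b (\sum_(i <- r | P i) E i) = \prod_(i <- r | P i) zeta R b (E i).
Proof. exact: (big_morph _ (@zetaD R b) (@zeta0 R b)). Qed.

Definition digit_character (n h : nat) (e : nat -> F) : R[i] :=
  zeta R b (\sum_(i < n) e i * nat_digit b h i).

Lemma digit_characterD n h (e e1 e2 : nat -> F) :
  (forall i, e i = e1 i + e2 i) ->
  digit_character n h e = digit_character n h e1 * digit_character n h e2.
Proof.
move=> eE; rewrite /digit_character !zeta_sum -big_split /=.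
apply: eq_bigr => i _; rewrite eE val_Fp_add -zetaD -mulnDl.
by rewrite -[LHS]zeta_modn// modnMml zeta_modn.
Qed.

Lemma digit_character_neq1 n h (e : nat -> F) (i0 : 'I_n) :
  e i0 != 0 -> nat_digit b h i0 != 0%N ->
  (forall i : 'I_n, i != i0 -> e i = 0 \/ nat_digit b h i = 0%N) ->
  digit_character n h e != 1.
Proof.
move=> ei0 hi0 rest; apply: zeta_neq1 => //.
rewrite (bigD1 i0)//= big1 => [|i /rest [->|->]]; rewrite ?muln0//.
rewrite addn0 Euclid_dvdM// negb_or; apply/andP; split; apply/negP => /dvdn_leq.
  by rewrite lt0n => /(_ ei0); rewrite leqNgt ltn_Fp.
by rewrite lt0n => /(_ hi0); rewrite leqNgt ltn_nat_digit.
Qed.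

Lemma coef_poly_of_nat m k i : (i < m)%N ->
  (poly_of_nat b m k)`_i = nat_digit b k i :> nat.
Proof.
by move=> im; rewrite coef_poly im val_Fp_nat// modn_small ?ltn_nat_digit.
Qed.

Lemma sum_poly_of_nat (V : nmodType) m (G : {poly F} -> V) :
  \sum_(k < b ^ m) G (poly_of_nat b m k) = \sum_(p : {poly_m F}) G p.
Proof.
pose f (k : 'I_(b ^ m)) : {poly_m F} := mk_npoly m (fun i => (nat_digit b k i)%:R).
have f_inj : injective f.
  move=> k l /(congr1 val) /= kl; apply/val_inj.
  apply: (@nat_digit_inj b b0 m) => [||i im]; try exact: ltn_ord.
  by rewrite -!(coef_poly_of_nat _ im) /poly_of_nat kl.
rewrite [RHS](reindex f)//; apply/onW_bij/inj_card_bij => //.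
by rewrite card_npoly card_Fp// card_ord.
Qed.

(** The integral of wal b h up to a factor, since this function is constant on
    the intervals of length b^-n. *)
Lemma sum_wal_nodes (h n : nat) : h != 0%N -> (h < b ^ n)%N ->
  \sum_(a < b ^ n) zeta R b
    (\sum_(i < n) nat_digit b a (n - i.+1) * nat_digit b h i) = 0.
Proof.
move=> h0 hn.
pose chi (p : {poly F}) := digit_character n h (fun i => p`_(n - i.+1)).
transitivity (\sum_(a < b ^ n) chi (poly_of_nat b n a)).
  apply: eq_bigr => a _; congr zeta; apply: eq_bigr => i _.
  by rewrite coef_poly_of_nat//; have := ltn_ord i; lia.
rewrite sum_poly_of_nat.
have [i0 hi0] : exists i0 : 'I_n, nat_digit b h i0 != 0%N.
  apply/existsP; apply: contraNT h0; rewrite negb_exists => /forallP h0.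
  rewrite -(modn_small hn) -/(dvdn _ _); apply: nat_digits_eq0 => // i lt_in.
  by have := h0 (Ordinal lt_in); rewrite negbK => /eqP.
pose a : {poly_n F} := mk_npoly n (fun i => (i == n - i0.+1)%N%:R).
apply: (character_sum (op := +%R) (a := a)) => [|p|]; first exact: addrI.
  by apply: digit_characterD => i /=; rewrite coefD.
have lt_i0 := ltn_ord i0.
apply: (@digit_character_neq1 n h _ i0) => // [|i ii0]; rewrite coef_poly.
  by rewrite ifT ?eqxx//; lia.
left; rewrite ifT; last by lia.
have lt_i := ltn_ord i.
case: eqP => // e; case/eqP: ii0; apply/val_inj => /=; lia.
Qed.

Lemma laurent_digitD (a1 a2 P : {poly F}) i :
  laurent_digit (a1 + a2) P i = laurent_digit a1 P i + laurent_digit a2 P i.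
Proof. by rewrite /laurent_digit mulrDr divpD coefD. Qed.

(** Multiplying by X^i shifts the expansion of X^e / P, and X^(e + i) / P has no
    polynomial part as long as e + i < deg P. *)
Lemma laurent_digit_Xn (P : {poly F}) n e i : size P = n.+1 ->
  (e + i < n)%N -> laurent_digit 'X^e P i = 0.
Proof.
move=> sP ein; rewrite /laurent_digit -exprD divp_small ?coef0//.
by rewrite size_polyXn sP addnC.
Qed.

(** X^(e + i) and P now have the same degree, so that the quotient is a non-zero
    constant. *)
Lemma laurent_digit_Xn_neq0 (P : {poly F}) n e i : size P = n.+1 ->
  (e + i = n)%N -> laurent_digit 'X^e P i != 0.
Proof.
move=> sP ein; rewrite /laurent_digit -exprD addnC ein.
have P0 : P != 0 by rewrite -size_poly_gt0 sP.
have sq : size ('X^n %/ P) = 1%N.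
  by rewrite size_divp// size_polyXn sP /= subSnn.
have q0 : 'X^n %/ P != 0 by rewrite -size_poly_gt0 sq.
by rewrite -lead_coef_eq0 lead_coefE sq in q0.
Qed.

Variables (m : nat) (P : {poly F}).
Local Notation n := (size P).-1.
Hypotheses (irrP : irreducible_poly P) (mn : (m <= n)%N).

Let sP : size P = n.+1. Proof. by case: irrP; case: (size P). Qed.

Let P0 : P != 0. Proof. exact: irredp_neq0. Qed.

(** The value of wal b h at a node with numerator a; as a function of a it is a
    character of the additive group F_b[X] / P. *)
Definition laurent_character (h : nat) (a : {poly F}) : R[i] :=
  digit_character n h (fun i => laurent_digit a P i.+1).

Lemma laurent_characterD h a1 a2 :
  laurent_character h (a1 + a2) = laurent_character h a1 * laurent_character h a2.
Proof. by apply: digit_characterD => i; exact: laurent_digitD. Qed.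

Lemma laurent_character0 h : laurent_character h 0 = 1.
Proof.
rewrite /laurent_character /digit_character big1 ?zeta0// => i _.
by rewrite /laurent_digit mulr0 div0p coef0.
Qed.

Lemma laurent_character_nontrivial h : ~~ (b ^ n %| h)%N ->
  exists2 a : {poly F}, (size a <= n)%N & laurent_character h a != 1.
Proof.
move=> bh; have [j0 hj0] : exists i0 : 'I_n, nat_digit b h i0 != 0%N.
  apply/existsP; apply: contraNT bh; rewrite negb_exists => /forallP h0.
  apply: nat_digits_eq0 => // i lt_in.
  by have := h0 (Ordinal lt_in); rewrite negbK => /eqP.
(* The last non-zero one among the first n digits of h, so that the later
   Laurent digits of the witness are irrelevant. *)
have [i0 hi0 max_i0] :=
  @arg_maxnP _ j0 (fun i : 'I_n => nat_digit b h i != 0%N) (fun i => i) hj0.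
have lt_i0 := ltn_ord i0.
exists ('X^(n - i0.+1)); first by rewrite size_polyXn; lia.
apply: (@digit_character_neq1 n h _ i0) => //.
  by apply: laurent_digit_Xn_neq0 sP _; lia.
move=> i ii0; have [lt_ii|le_ii] := ltnP i i0.
  by left; apply: laurent_digit_Xn sP _; lia.
right; apply/eqP/negPn/negP => /max_i0 le_i; case/eqP: ii0; apply/val_inj => /=.
by apply/eqP; rewrite eqn_leq le_ii andbT; exact: le_i.
Qed.

(** As P is irreducible and K is prime to it, multiplication by K is injective
    modulo P, hence surjective on the finitely many residues. *)
Lemma mulmod_surj (K a : {poly F}) : K != 0 -> (size K <= n)%N -> (size a <= n)%N ->
  exists z : {poly_n F}, ((z : {poly F}) * K) %% P = a.
Proof.
move=> K0 sK sa.
pose f (z : {poly_n F}) : {poly_n F} := npolyp n (((z : {poly F}) * K) %% P).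
have fE z : f z = ((z : {poly F}) * K) %% P :> {poly F}.
  by apply: npolypK; rewrite -ltnS -sP ltn_modp.
have f_inj : injective f.
  move=> y z /(congr1 val) /= yz; apply/val_inj/eqP; rewrite -subr_eq0 /=.
  have szD : (size (polyn y - polyn z)%R <= n)%N := size_npoly (y - z).
  apply: contraTT isT => yz0; have PK : coprimep P K.
    rewrite irreducible_poly_coprime//; apply/negP => /(dvdp_leq K0).
    by rewrite leqNgt sP ltnS sK.
  have : P %| (polyn y - polyn z) * K.
    by apply/modp_eq0P; rewrite mulrBl modpD modpN -!fE yz subrr.
  rewrite Gauss_dvdpl// => /(dvdp_leq yz0) /leq_trans/(_ szD).
  by rewrite leqNgt {2}sP ltnSn.
have [g _ gK] := injF_bij f_inj.
by exists (g (npolyp n a)); rewrite -fE gK npolypK.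
Qed.

Let S := polynomial_lattice_rule R m P.

Lemma wal_coord h (z : gen S) k :
  wal b h (Defs.coord z k) =
  laurent_character h (((z : {poly F}) * poly_of_nat b m k) %% P).
Proof.
exact: (@wal_finite_digits b b0 R h n
  (fun i => laurent_digit ((polyn z * poly_of_nat b m k) %% P) P i)
  (fun=> ltn_Fp _)).
Qed.

Lemma card_gen_polynomial : #|gen S| = (b ^ n)%N.
Proof. by rewrite card_npoly card_Fp. Qed.

Lemma mulrn_nat (l k : nat) : l *+ k = (l * k)%N.
Proof. by elim: k => [|k IH]; rewrite ?muln0// mulrS IH mulnS. Qed.

Let integral_wal h : (h != 0)%N ->
  [/\ measurable_fun (`[0, 1[ : set R) (fun x : R => complex.Re (wal b h x)),
      measurable_fun (`[0, 1[ : set R) (fun x : R => complex.Im (wal b h x)),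
      \int[@unit_measure R]_(x in `[0, 1[) complex.Re (wal b h x) = 0 &
      \int[@unit_measure R]_(x in `[0, 1[) complex.Im (wal b h x) = 0].
Proof.
(* As h < b ^ h, the function wal b h is constant on the cells of length b^-h. *)
move=> h0; have hb : (h < b ^ h)%N by apply: ltn_expl; exact: prime_gt1.
pose c a := zeta R b (\sum_(i < h) nat_digit b a (h - i.+1) * nat_digit b h i).
have bh0 : (0 < b ^ h)%N by rewrite expn_gt0 b0.
have cE (x : R) : 0 <= x < 1 -> wal b h x = c (Num.truncn ((b ^ h)%N%:R * x)).
  by case/andP => x0 _; rewrite natrX; exact: wal_small.
have sc : \sum_(a < b ^ h) c a = 0 by exact: sum_wal_nodes.
have cRe (x : R) : 0 <= x < 1 ->
    complex.Re (wal b h x) = complex.Re (c (Num.truncn ((b ^ h)%N%:R * x))).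
  by move=> /cE ->.
have cIm (x : R) : 0 <= x < 1 ->
    complex.Im (wal b h x) = complex.Im (c (Num.truncn ((b ^ h)%N%:R * x))).
  by move=> /cE ->.
split.
- by apply: (@measurable_step R _ (fun a => complex.Re (c a)) _ bh0); exact: cRe.
- by apply: (@measurable_step R _ (fun a => complex.Im (c a)) _ bh0); exact: cIm.
- by rewrite (@integral_step R _ (fun a => complex.Re (c a)) _ bh0 cRe) -Re_sum sc mulr0.
- by rewrite (@integral_step R _ (fun a => complex.Im (c a)) _ bh0 cIm) -Im_sum sc mulr0.
Qed.

Let wal0 (x : R) : wal b 0 x = 1.
Proof. by rewrite /wal big_ord0 mul0r e2pi0. Qed.

Lemma polynomial_character_rule : character_rule (S := S) (wal b).
Proof.
split.
- by [].
- exact: wal0.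
- by move=> h x; exact: normc_e2pi.
- move=> h; have [->|/integral_wal[]//] := eqVneq h 0%N.
  rewrite (_ : (fun x => _) = cst (complex.Re (1 : R[i])))//.
  by apply/funext => x; rewrite [wal _ _ _]wal0.
- move=> h; have [->|/integral_wal[]//] := eqVneq h 0%N.
  rewrite (_ : (fun x => _) = cst (complex.Im (1 : R[i])))//.
  by apply/funext => x; rewrite [wal _ _ _]wal0.
- by move=> h /integral_wal[].
- by move=> h /integral_wal[].
- by rewrite /= expn_gt0 b0.
- by rewrite card_gen_polynomial expn_gt0 b0.
- move=> z k; exact: (@radix_fraction_itv b b0 R n
    (fun i => laurent_digit ((polyn z * poly_of_nat b m k) %% P) P i)
    (fun=> ltn_Fp _)).
- move=> h l /=; rewrite card_gen_polynomial !mulrn_nat => /eqP.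
  by rewrite eqn_pmul2r ?expn_gt0 ?b0// => /eqP.
- move=> d z h.
  pose chi (p : {poly F}) := \prod_(j < d)
    laurent_character (tnth h j) ((polyn (tnth z j) * p) %% P).
  have chiD p q : chi (p + q) = chi p * chi q.
    rewrite /chi -big_split /=; apply: eq_bigr => j _.
    by rewrite mulrDr modpD laurent_characterD.
  rewrite (eq_bigr (fun k : 'I__ => chi (poly_of_nat b m k))); last first.
    by move=> k _; apply: eq_bigr => j _; rewrite wal_coord.
  rewrite sum_poly_of_nat.
  have [/forallP chi1|/forallPn[a chia]] :=
    boolP [forall a : {poly_m F}, chi a == 1]; [right|left].
    rewrite (eq_bigr (fun=> 1)); last by move=> k _; exact/eqP/chi1.
    rewrite sumr_const card_npoly card_Fp//= mulVf// pnatr_eq0.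
    by rewrite -lt0n expn_gt0 b0.
  rewrite (@character_sum _ _ +%R (fun p : {poly_m F} => chi p) a) ?mulr0//.
  by move=> p; exact: chiD.
- move=> h k /= kN hN; have [->|k0] := eqVneq k 0%N.
    rewrite (eq_bigr (fun=> 1)) ?sumr_const ?cardT// => z _.
    rewrite wal_coord (_ : poly_of_nat _ _ _ = 0) ?mulr0 ?mod0p.
      exact: laurent_character0.
    by apply/polyP => i; rewrite coef_poly coef0 /nat_digit div0n mod0n if_same.
  have K0 : poly_of_nat b m k != 0.
    apply: contra k0 => /eqP K0; rewrite -(modn_small kN).
    apply: nat_digits_eq0 => // i im.
    by rewrite -(coef_poly_of_nat _ im) K0 coef0.
  have [a sa chia] : exists2 a : {poly F},
      (size a <= n)%N & laurent_character h a != 1.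
    apply: laurent_character_nontrivial; apply/negP => /dvdnP[l hl].
    by apply: (hN l); rewrite card_gen_polynomial mulrn_nat.
  have [z za] := mulmod_surj K0 (leq_trans (size_poly _ _) mn) sa.
  apply: (@character_sum _ _ +%R _ z) => [||].
  - exact: addrI.
  - by move=> y; rewrite !wal_coord /= mulrDl modpD laurent_characterD.
  - by rewrite wal_coord za.
Qed.

End PolynomialRule.

(** * Finite partial sums of unconditional sums *)


Lemma big_fset_sub (V : nmodType) (I : choiceType) (A B : {fset I}) (F : I -> V) :
  (A `<=` B)%fset ->
  \sum_(i <- B | i \in A) F i = \sum_(i <- A) F i.
Proof.
move=> AB; rewrite big_fset_condE; apply: eq_fbigl => i; rewrite !inE /=.
by apply/andP/idP => [[]//|iA]; split => //; exact: (fsubsetP AB).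
Qed.

Section FiniteSubsums.
Local Open Scope ereal_scope.
Context {R : realType} {I : choiceType}.
Implicit Types (D : set I) (a : I -> \bar R).

Lemma fsubsum_le_esum D a (A : {fset I}) : (forall i, D i -> 0 <= a i) ->
  (forall i, i \in A -> D i) -> \sum_(i <- A) a i <= \esum_(i in D) a i.
Proof.
move=> a0 AD; apply: ereal_sup_ubound; exists [set` A].
  by split=> //; exact: finite_fset.
by rewrite fsbig_finite//= set_fsetK.
Qed.

Lemma esum_le_fsubsums D a (M : \bar R) :
  (forall A : {fset I}, (forall i, i \in A -> D i) -> \sum_(i <- A) a i <= M) ->
  \esum_(i in D) a i <= M.
Proof.
move=> AM; apply: ge_ereal_sup => _ [A [finA AD] <-].
rewrite fsbig_finite//; apply: AM => i; rewrite in_fset_set// inE.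
exact: AD.
Qed.

Lemma esum_fsubsum_approx a (e : R) : (0 < e)%R -> (forall i, 0 <= a i) ->
  \esum_(i in setT) a i < +oo ->
  exists A : {fset I}, forall B : {fset I}, (A `<=` B)%fset ->
    \sum_(i <- B | i \notin A) a i <= e%:E.
Proof.
move=> e0 a0 fin.
have finE : \esum_(i in setT) a i \is a fin_num.
  by rewrite ge0_fin_numE// esum_ge0.
have [A hA] : exists A : {fset I}, \esum_(i in setT) a i - e%:E <= \sum_(i <- A) a i.
  apply/not_existsP => noA.
  have : \esum_(i in setT) a i <= \esum_(i in setT) a i - e%:E.
    apply: esum_le_fsubsums => A _; apply/ltW; rewrite ltNge; exact/negP/noA.
  move: finE; case: (\esum_(i in setT) a i) => // x _.
  by rewrite -EFinB lee_fin lerBrDr gerDl leNgt e0.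
exists A => B AB.
have : \sum_(i <- A) a i + \sum_(i <- B | i \notin A) a i <= \esum_(i in setT) a i.
  rewrite -(big_fset_sub a AB) [leLHS](_ : _ = \sum_(i <- B) a i).
    exact: fsubsum_le_esum.
  by rewrite [RHS](bigID (mem A)).
have finA : \sum_(i <- A) a i \is a fin_num.
  rewrite ge0_fin_numE ?sume_ge0//; apply: le_lt_trans fin.
  exact: fsubsum_le_esum.
have : \esum_(i in setT) a i <= \sum_(i <- A) a i + e%:E.
  by rewrite -leeBlDr.
move=> h1 h2; have := le_trans h2 h1.
by rewrite leeD2lE.
Qed.

End FiniteSubsums.

(** * Integrals of bounded complex functions *)


(** Such functions form an algebra on which integration against a probability
    measure is linear without further conditions. *)
Definition bounded_measurable d (T : measurableType d) (R : realType)
    (f : T -> R[i]) : Prop :=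
  [/\ measurable_fun setT (fun x => complex.Re (f x)),
      measurable_fun setT (fun x => complex.Im (f x)) &
      exists M : R, forall x, normc (f x) <= M].

Definition complex_integral d (T : measurableType d) (R : realType)
    (mu : {measure set T -> \bar R}) (f : T -> R[i]) : R[i] :=
  Complex (\int[mu]_x complex.Re (f x)) (\int[mu]_x complex.Im (f x)).

Section ComplexIntegral.
Context d (T : measurableType d) (R : realType) (mu : probability T R).
Implicit Types f g : T -> R[i].

Lemma bounded_integrable (f : T -> R) (M : R) : measurable_fun setT f ->
  (forall x, `|f x| <= M) -> mu.-integrable setT (EFin \o f).
Proof.
move=> mf fM; apply: measurable_bounded_integrable => //.
  exact: le_lt_trans (probability_le1 mu measurableT) (ltry 1).
exists M; split; first exact: num_real.
by move=> N MN x _; apply: le_trans (fM x) _; exact: ltW.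
Qed.

Lemma bounded_measurable_Re f : bounded_measurable f ->
  mu.-integrable setT (EFin \o (fun x => complex.Re (f x))).
Proof.
case=> mf _ [M fM]; apply: (@bounded_integrable _ M) => // x.
exact: le_trans (le_Re_normc _) (fM x).
Qed.

Lemma bounded_measurable_Im f : bounded_measurable f ->
  mu.-integrable setT (EFin \o (fun x => complex.Im (f x))).
Proof.
case=> _ mf [M fM]; apply: (@bounded_integrable _ M) => // x.
exact: le_trans (le_Im_normc _) (fM x).
Qed.

Lemma bounded_measurable_cst (c : R[i]) : bounded_measurable (fun _ : T => c).
Proof. by split; [exact: measurable_cst..|exists (normc c)]. Qed.

Lemma bounded_measurableD f g : bounded_measurable f -> bounded_measurable g ->
  bounded_measurable (fun x => f x + g x).
Proof.
case=> mRf mIf [M fM] [mRg mIg [N gN]]; split.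
- by under eq_fun do rewrite Re_add; exact: measurable_funD.
- by under eq_fun do rewrite Im_add; exact: measurable_funD.
- by exists (M + N) => x; apply: le_trans (le_normc_add _ _) _; rewrite lerD.
Qed.

Lemma bounded_measurableM f g : bounded_measurable f -> bounded_measurable g ->
  bounded_measurable (fun x => f x * g x).
Proof.
case=> mRf mIf [M fM] [mRg mIg [N gN]]; split.
- under eq_fun do rewrite Re_mul.
  by apply: measurable_funB; exact: measurable_funM.
- under eq_fun do rewrite Im_mul.
  by apply: measurable_funD; exact: measurable_funM.
- by exists (M * N) => x; rewrite normcM ler_pM// normc_ge0.
Qed.

Lemma bounded_measurable_sum (I : Type) (s : seq I) (P : pred I)
    (F : I -> T -> R[i]) : (forall i, bounded_measurable (F i)) ->
  bounded_measurable (fun x => \sum_(i <- s | P i) F i x).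
Proof.
move=> mF; elim: s => [|i s IH].
  by under eq_fun do rewrite big_nil; exact: bounded_measurable_cst.
under eq_fun do rewrite big_cons; case: (P i) => //.
exact: bounded_measurableD.
Qed.

Lemma complex_integralD f g : bounded_measurable f -> bounded_measurable g ->
  complex_integral mu (fun x => f x + g x) =
  complex_integral mu f + complex_integral mu g.
Proof.
move=> bf bg; rewrite /complex_integral; congr Complex.
  under eq_Rintegral do rewrite Re_add.
  by apply: RintegralD => //; exact: bounded_measurable_Re.
under eq_Rintegral do rewrite Im_add.
by apply: RintegralD => //; exact: bounded_measurable_Im.
Qed.

Lemma complex_integralZ (c : R[i]) f : bounded_measurable f ->
  complex_integral mu (fun x => c * f x) = c * complex_integral mu f.
Proof.
move=> bf; have iR := bounded_measurable_Re bf; have iI := bounded_measurable_Im bf.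
have cZ (a : R) (h : T -> R) : mu.-integrable setT (EFin \o h) ->
    mu.-integrable setT (EFin \o (fun x => a * h x)).
  by move=> ih; have := integrableZl measurableT a ih.
rewrite /complex_integral; case: c => a b; congr Complex.
  under eq_Rintegral do rewrite Re_mul /=.
  by rewrite RintegralB//= ?RintegralZl//; exact: cZ.
under eq_Rintegral do rewrite Im_mul /=.
by rewrite RintegralD//= ?RintegralZl//; exact: cZ.
Qed.

Lemma complex_integral_sum (I : Type) (s : seq I) (c : I -> R[i])
    (F : I -> T -> R[i]) : (forall i, bounded_measurable (F i)) ->
  complex_integral mu (fun x => \sum_(i <- s) c i * F i x) =
  \sum_(i <- s) c i * complex_integral mu (F i).
Proof.
move=> mF; elim: s => [|i s IH].
  rewrite big_nil /complex_integral.
  under eq_Rintegral do rewrite big_nil.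
  under [X in Complex _ X]eq_Rintegral do rewrite big_nil.
  by rewrite !Rintegral_cst//= !mul0r.
rewrite big_cons -IH -complex_integralZ// -complex_integralD.
- by congr complex_integral; apply/funext => x; rewrite big_cons.
- by apply: bounded_measurableM => //; exact: bounded_measurable_cst.
- apply: bounded_measurable_sum => j.
  by apply: bounded_measurableM => //; exact: bounded_measurable_cst.
Qed.

Lemma le_normc_complex_integral f (M : R) : bounded_measurable f ->
  (forall x, normc (f x) <= M) -> normc (complex_integral mu f) <= M + M.
Proof.
move=> bf fM; apply: le_trans (normc_le_ReIm _ _) _.
have bound (h : T -> R) : mu.-integrable setT (EFin \o h) ->
    (forall x, `|h x| <= M) -> `|\int[mu]_x h x| <= M.
  move=> ih hM; apply: le_trans (le_normr_Rintegral _ ih) _ => //.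
  apply: (@le_trans _ _ (\int[mu]_x cst M x)).
    apply: le_Rintegral => //.
      exact: integrable_norm.
    exact: finite_measure_integrable_cst.
  rewrite Rintegral_cst// [X in fine X](_ : _ = 1%E) ?mulr1//.
  exact: probability_setT.
by apply: lerD; apply: bound => [|x];
  [exact: bounded_measurable_Re|exact: le_trans (le_Re_normc _) _
  |exact: bounded_measurable_Im|exact: le_trans (le_Im_normc _) _].
Qed.

(** A function of the unit ball is only given by a convergent series; this is
    where its measurability on the cube comes from. *)
Lemma bounded_measurable_uniform f :
  (forall e : R, 0 < e -> exists2 g, bounded_measurable g &
     forall x, normc (f x - g x) <= e) ->
  bounded_measurable f.
Proof.
move=> approx.
have cvg_of (h : T -> R) (k : nat -> T -> R) :
    (forall n, measurable_fun setT (k n)) ->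
    (forall n x, `|h x - k n x| <= n.+1%:R^-1) -> measurable_fun setT h.
  move=> mk hk; apply: (measurable_fun_cvg mk) => x _.
  apply/cvgrPdist_le => e e0; near=> n.
  apply: le_trans (hk n x) _; near: n.
  by have /cvgrPdist_le/(_ e e0) := @cvg_harmonic R; apply: filterS => n;
    rewrite sub0r normrN ger0_norm ?invr_ge0.
have /choice[g gP] (n : nat) : exists g, bounded_measurable g /\
    forall x, normc (f x - g x) <= n.+1%:R^-1.
  by have [|g] := approx n.+1%:R^-1; [rewrite invr_gt0|exists g].
split.
- apply: (cvg_of _ (fun n x => complex.Re (g n x))) => [n|n x].
    by have [[]] := gP n.
  have [_ /(_ x)] := gP n; apply: le_trans.
  by rewrite -Re_sub le_Re_normc.
- apply: (cvg_of _ (fun n x => complex.Im (g n x))) => [n|n x].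
    by have [[]] := gP n.
  have [_ /(_ x)] := gP n; apply: le_trans.
  by rewrite -Im_sub le_Im_normc.
- have [[_ _ [M gM]] fg] := gP 0%N; exists (1 + M) => x.
  rewrite -[f x](subrK (g 0%N x)); apply: le_trans (le_normc_add _ _) _.
  by rewrite lerD// (le_trans (fg x))// invr1.
Unshelve. all: by end_near. Qed.
End ComplexIntegral.

(** * Integrals of basis functions over the cube *)


Lemma bounded_measurable_comp d d' (T : measurableType d) (U : measurableType d')
    (R : realType) (f : U -> R[i]) (g : T -> U) :
  bounded_measurable f -> measurable_fun setT g -> bounded_measurable (f \o g).
Proof.
case=> mR mI [M fM] mg; split.
- exact: (measurableT_comp mR mg).
- exact: (measurableT_comp mI mg).
- by exists M => x; exact: fM.
Qed.

Section ProductIntegral.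
Context d1 d2 (T1 : measurableType d1) (T2 : measurableType d2) (R : realType).
Variables (P1 : probability T1 R) (P2 : probability T2 R).

Lemma Rintegral_tensor (a : T1 -> R) (g : T2 -> R) (M N : R) :
  measurable_fun setT a -> (forall x, `|a x| <= M) ->
  measurable_fun setT g -> (forall y, `|g y| <= N) ->
  \int[(P1 \x P2)%E]_z (a z.1 * g z.2) = \int[P1]_x a x * \int[P2]_y g y.
Proof.
move=> ma aM mg gN.
have ia := bounded_integrable P1 ma aM.
have ig := bounded_integrable P2 mg gN.
have mz : measurable_fun setT (fun z : T1 * T2 => a z.1 * g z.2).
  by apply: measurable_funM; apply: measurableT_comp.
have iz : (P1 \x P2)%E.-integrable setT (EFin \o (fun z : T1 * T2 => a z.1 * g z.2)).
  apply: (@bounded_integrable _ _ _ (P1 \x P2)%E _ (M * N)) => // z.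
  by rewrite normrM ler_pM.
transitivity (\int[P1]_x ((\int[P2]_y g y) * a x)); last first.
  by rewrite (RintegralZl _ _ ia)// mulrC.
rewrite /Rintegral -(integral12_prod_meas1 iz) /fubini_F /=; congr fine.
apply: eq_integral => x _; rewrite mulrC EFinM fineK; last first.
  exact: integrable_fin_num.
exact: (integralZl _ ig).
Qed.

(** Expanding f x * g y into real and imaginary parts reduces the claim to the
    real case, which is Fubini's theorem. *)
Lemma complex_integral_tensor (f : T1 -> R[i]) (g : T2 -> R[i]) :
  bounded_measurable f -> bounded_measurable g ->
  complex_integral (P1 \x P2)%E (fun z => f z.1 * g z.2) =
  complex_integral P1 f * complex_integral P2 g.
Proof.
move=> bf bg; have [mRf mIf [M fM]] := bf; have [mRg mIg [N gN]] := bg.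
have RM x : `|complex.Re (f x)| <= M by exact: le_trans (le_Re_normc _) (fM x).
have IM x : `|complex.Im (f x)| <= M by exact: le_trans (le_Im_normc _) (fM x).
have RN x : `|complex.Re (g x)| <= N by exact: le_trans (le_Re_normc _) (gN x).
have IN x : `|complex.Im (g x)| <= N by exact: le_trans (le_Im_normc _) (gN x).
have int_tensor (a : T1 -> R) (h : T2 -> R) : measurable_fun setT a -> (forall x, `|a x| <= M) ->
    measurable_fun setT h -> (forall y, `|h y| <= N) ->
    (P1 \x P2)%E.-integrable setT (EFin \o (fun z : T1 * T2 => a z.1 * h z.2)).
  move=> ma aM mh hN.
  apply: (@bounded_integrable _ _ _ (P1 \x P2)%E _ (M * N)) => [|z].
    by apply: measurable_funM; apply: measurableT_comp.
  by rewrite normrM ler_pM.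
rewrite /complex_integral; congr Complex.
  under eq_Rintegral do rewrite Re_mul.
  rewrite (RintegralB measurableT (int_tensor _ _ mRf RM mRg RN)
    (int_tensor _ _ mIf IM mIg IN)).
  rewrite (Rintegral_tensor mRf RM mRg RN) (Rintegral_tensor mIf IM mIg IN).
  by [].
under eq_Rintegral do rewrite Im_mul.
rewrite (RintegralD measurableT (int_tensor _ _ mRf RM mIg IN)
  (int_tensor _ _ mIf IM mRg RN)).
rewrite (Rintegral_tensor mRf RM mIg IN) (Rintegral_tensor mIf IM mRg RN).
by [].
Qed.

End ProductIntegral.

Section CubeIntegral.
Variables (R : realType) (S : qmc_rule R) (phi : freq S -> R -> R[i]).
Hypothesis HS : character_rule phi.

(** Cutting phi h off makes it measurable on the whole line, and products of
    such functions vanish outside the cube, so that Fubini's theorem applies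
    without domains. *)
Definition cutoff (h : freq S) (x : measurableTypeR R) : R[i] :=
  if 0 <= x < 1 then phi h x else 0.

Lemma bounded_measurable_cutoff h : bounded_measurable (cutoff h).
Proof.
split.
- rewrite (_ : (fun x => _) = (fun x : R => complex.Re (phi h x)) \_ `[0, 1[).
    by apply: (measurable_restrictT _ (measurable_itv `[0, 1[)).1; exact: (measurable_Re_phi HS).
  apply/funext => x; rewrite /cutoff patchE mem_setE in_itv /=.
  by case: ifP.
- rewrite (_ : (fun x => _) = (fun x : R => complex.Im (phi h x)) \_ `[0, 1[).
    by apply: (measurable_restrictT _ (measurable_itv `[0, 1[)).1; exact: (measurable_Im_phi HS).
  apply/funext => x; rewrite /cutoff patchE mem_setE in_itv /=.
  by case: ifP.
- exists 1 => x; rewrite /cutoff; case: ifP => _; last by rewrite normc0.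
  by rewrite (normc_phi HS).
Qed.

Lemma complex_integral_cutoff h :
  complex_integral (@unit_measure R) (cutoff h) = (h == 0)%:R.
Proof.
have ReE : \int[@unit_measure R]_x complex.Re (cutoff h x) =
    \int[@unit_measure R]_(x in `[0, 1[) complex.Re (phi h x).
  rewrite [RHS]Rintegral_mkcond; apply: eq_Rintegral => x _.
  by rewrite /cutoff patchE mem_setE in_itv /=; case: ifP.
have ImE : \int[@unit_measure R]_x complex.Im (cutoff h x) =
    \int[@unit_measure R]_(x in `[0, 1[) complex.Im (phi h x).
  rewrite [RHS]Rintegral_mkcond; apply: eq_Rintegral => x _.
  by rewrite /cutoff patchE mem_setE in_itv /=; case: ifP.
rewrite /complex_integral ReE ImE; have [->|h0] := eqVneq h 0; last first.
  by rewrite (integral_Re_phi HS h0) (integral_Im_phi HS h0).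
under eq_Rintegral do rewrite (phi0 HS) /=.
under [X in Complex _ X]eq_Rintegral do rewrite (phi0 HS) /=.
rewrite !Rintegral_unit_measure !Rintegral_cst//= mul0r mul1r.
by rewrite lebesgue_measure_itv /= lte_fin ltr01 -EFinB /= subr0.
Qed.

Definition cube_basis d (h : d.-tuple (freq S)) (x : d.-tuple (measurableTypeR R)) :
  R[i] := \prod_(j < d) cutoff (tnth h j) (tnth x j).

Lemma bounded_measurable_cube_basis d (h : d.-tuple (freq S)) :
  bounded_measurable (cube_basis h).
Proof.
rewrite /cube_basis; elim: (index_enum _) => [|j s IH].
  by under eq_fun do rewrite big_nil; exact: bounded_measurable_cst.
under eq_fun do rewrite big_cons.
apply: bounded_measurableM => //.
apply: (bounded_measurable_comp (bounded_measurable_cutoff _)).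
exact: measurable_tnth.
Qed.

Lemma zero_freqP d (h : d.-tuple (freq S)) :
  reflect (forall j, tnth h j = 0) (h == zero_freq S d).
Proof.
apply: (iffP eqP) => [-> j|h0]; first by rewrite tnth_mktuple.
by apply: eq_from_tnth => j; rewrite h0 tnth_mktuple.
Qed.

Lemma prod_delta_zero_freq (K : fieldType) d (h : d.-tuple (freq S)) :
  \prod_(j < d) ((tnth h j == 0)%:R : K) = (h == zero_freq S d)%:R.
Proof.
case: (zero_freqP h) => [h0|/existsNP[j /eqP hj]].
  by rewrite big1// => j _; rewrite h0 eqxx.
by rewrite (bigD1 j)//= (negPf hj) mul0r.
Qed.

Lemma complex_integral_distribution d1 d2 (T1 : measurableType d1)
    (T2 : measurableType d2) (P : probability T1 R) (X : {RV P >-> T2})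
    (f : T2 -> R[i]) : bounded_measurable f ->
  complex_integral (distribution P X) f = complex_integral P (f \o X).
Proof.
move=> bf; have [mR mI _] := bf.
have bfX : bounded_measurable (f \o X) by exact: bounded_measurable_comp bf _.
rewrite /complex_integral /Rintegral; congr (Complex (fine _) (fine _)).
  apply: (@integral_distribution _ _ _ _ _ P X (EFin \o (fun y => complex.Re (f y)))).
    exact/measurable_EFinP.
  exact: (bounded_measurable_Re P bfX).
apply: (@integral_distribution _ _ _ _ _ P X (EFin \o (fun y => complex.Im (f y)))).
  exact/measurable_EFinP.
exact: (bounded_measurable_Im P bfX).
Qed.

(** The cube measure being an iterated product, the integral factors into the
    one-dimensional ones. *)
Lemma complex_integral_cube_basis d (h : d.-tuple (freq S)) :
  complex_integral (cube_measure R d) (cube_basis h) = (h == zero_freq S d)%:R.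
Proof.
rewrite -prod_delta_zero_freq.
elim: d h => [|d IH] h.
  rewrite big_ord0 (_ : cube_basis h = fun=> 1).
    rewrite /complex_integral !Rintegral_cst//= mul0r mul1r.
    by rewrite /dirac indicE mem_setT.
  by apply/funext => x; rewrite /cube_basis big_ord0.
case/tupleP: h => h0 h; rewrite big_ord_recl /= tnth0.
under eq_bigr do rewrite tnthS.
rewrite -IH -complex_integral_cutoff.
rewrite (complex_integral_distribution _ (bounded_measurable_cube_basis _)).
rewrite -(complex_integral_tensor _ _ (bounded_measurable_cutoff _)
  (bounded_measurable_cube_basis _)).
congr complex_integral; apply/funext => -[x y] /=.
rewrite /cube_basis big_ord_recl /= /cons_coord /= !tnth0; congr (_ * _).
by apply: eq_bigr => j _; rewrite !tnthS.
Qed.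

End CubeIntegral.

(** * The quadrature error of an absolutely convergent series *)


Section QuadratureError.
Variables (R : realType) (S : qmc_rule R) (phi : freq S -> R -> R[i]).
Hypothesis HS : character_rule phi.
Variable d : nat.
Implicit Types (h : d.-tuple (freq S)) (x : d.-tuple R) (z : d.-tuple (gen S)).

Definition average z h : R[i] := (npoints S)%:R^-1 *
  \sum_(k < npoints S) \prod_(j < d) phi (tnth h j) (Defs.coord (tnth z j) k).

Definition in_dual z h : bool := average z h == 1.

(** This makes averages over the nodes indicators of the dual. *)
Lemma averageE z h : average z h = (in_dual z h)%:R.
Proof.
rewrite /in_dual; have := average_01 HS z h; rewrite -/(average z h) => -[] ->.
  by rewrite eq_sym oner_eq0.
by rewrite eqxx.
Qed.

Lemma average_zero_freq z : average z (zero_freq S d) = 1.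
Proof.
rewrite /average (eq_bigr (fun=> 1)).
  by rewrite sumr_const card_ord mulVf// pnatr_eq0 -lt0n (npoints_gt0 HS).
by move=> k _; rewrite big1// => j _; rewrite tnth_mktuple (phi0 HS).
Qed.

Definition quadrature_error z (f : d.-tuple R -> R[i]) : R[i] :=
  quadrature z f - cube_integral f.

Lemma mem_qmc_point z k : qmc_point z k \in @cube R d.
Proof.
by rewrite inE => j; rewrite tnth_mktuple; exact: (coord_itv HS).
Qed.

Definition cut (f : d.-tuple R -> R[i]) (x : d.-tuple (measurableTypeR R)) : R[i] :=
  if x \in @cube R d then f x else 0.

Lemma cube_integralE f :
  cube_integral f = complex_integral (cube_measure R d) (cut f).
Proof.
rewrite /cube_integral /complex_integral; congr Complex;
  rewrite Rintegral_mkcond; apply: eq_Rintegral => x _;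
  by rewrite /cut patchE; case: ifP.
Qed.

Lemma cube_basisE h x : cube_basis phi h x = cut (Defs.basis h) x.
Proof.
rewrite /cube_basis /cut; case: ifPn => [|/negP]; rewrite inE => hx.
  rewrite (basis_prod HS); apply: eq_bigr => j _.
  by rewrite /cutoff hx.
have /existsNP[j /negP hj] := hx.
by rewrite (bigD1 j)//= {1}/cutoff (negPf hj) mul0r.
Qed.

Definition partial_sum (c : d.-tuple (freq S) -> R[i])
  (A : {fset d.-tuple (freq S)}) x : R[i] := \sum_(h <- A) c h * Defs.basis h x.

Lemma cut_partial_sum c A :
  cut (partial_sum c A) = fun x => \sum_(h <- A) c h * cube_basis phi h x.
Proof.
apply/funext => x; under eq_bigr do rewrite cube_basisE.
by rewrite /cut /partial_sum; case: ifP => // _; rewrite big1// => h; rewrite mulr0.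
Qed.

Lemma bounded_measurable_partial_sum c A : bounded_measurable (cut (partial_sum c A)).
Proof.
rewrite cut_partial_sum; apply: bounded_measurable_sum => h.
apply: bounded_measurableM; first exact: bounded_measurable_cst.
exact: (bounded_measurable_cube_basis HS).
Qed.

(** The zero frequency cancels: its basis function is constant, and quadrature
    is exact on constants. *)
Lemma quadrature_error_partial_sum z c A :
  quadrature_error z (partial_sum c A) =
  \sum_(h <- A | (h != zero_freq S d) && in_dual z h) c h.
Proof.
rewrite /quadrature_error.
have -> : quadrature z (partial_sum c A) = \sum_(h <- A) c h * average z h.
  rewrite /quadrature /partial_sum exchange_big mulr_sumr /=.
  apply: eq_bigr => h _; rewrite /average -mulr_sumr mulrCA; congr (_ * (_ * _)).
  apply: eq_bigr => k _; rewrite (basis_prod HS).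
  by apply: eq_bigr => j _; rewrite tnth_mktuple.
rewrite cube_integralE cut_partial_sum.
rewrite complex_integral_sum; last by move=> h; exact: (bounded_measurable_cube_basis HS).
rewrite -sumrB [RHS]big_mkcond /=; apply: eq_bigr => h _.
rewrite (complex_integral_cube_basis HS) -mulrBr.
have [->|h0] /= := eqVneq h (zero_freq S d).
  by rewrite average_zero_freq subrr mulr0.
by rewrite subr0 averageE; case: in_dual; rewrite ?mulr1 ?mulr0.
Qed.

(** The quadrature error only sees f through its values on the cube, and is
    continuous for uniform convergence there. *)
Lemma quadrature_error_uniform z f g (e : R) :
  bounded_measurable (cut g) ->
  (forall e' : R, 0 < e' -> exists2 k, bounded_measurable (cut k) &
     forall x, x \in @cube R d -> normc (f x - k x) <= e') ->
  (forall x, x \in @cube R d -> normc (f x - g x) <= e) ->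
  normc (quadrature_error z f) <= normc (quadrature_error z g) + e *+ 3.
Proof.
move=> bg approx fg.
have e0 : 0 <= e.
  by apply: le_trans (fg _ (mem_qmc_point z 0)); exact: normc_ge0.
have cutB (k : d.-tuple R -> R[i]) (e' : R) : 0 <= e' ->
    (forall x, x \in @cube R d -> normc (f x - k x) <= e') ->
    forall x, normc (cut f x - cut k x) <= e'.
  move=> e'0 fk x; rewrite /cut; case: ifP => [/fk//|_].
  by rewrite subr0 normc0.
have bf : bounded_measurable (cut f).
  apply: bounded_measurable_uniform => e' e'0; have [k bk fk] := approx _ e'0.
  by exists (cut k) => //; apply: cutB => //; exact: ltW.
have -> : quadrature_error z f = quadrature_error z g +
    ((quadrature z f - quadrature z g) - (cube_integral f - cube_integral g)).
  by rewrite /quadrature_error; ring.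
apply: le_trans (le_normc_add _ _) _; rewrite lerD2l.
apply: le_trans (le_normc_add _ _) _; rewrite mulrS lerD//.
  rewrite /quadrature -mulrBr -sumrB normcM.
  have N0 : 0 < (npoints S)%:R :> R by rewrite ltr0n (npoints_gt0 HS).
  have -> : normc ((npoints S)%:R^-1 : R[i]) = (npoints S)%:R^-1.
    by rewrite normcV normc_nat.
  rewrite ler_pdivrMl//; apply: le_trans (le_normc_sum _ _ _) _.
  apply: (@le_trans _ _ (\sum_(k < npoints S) e)).
    by apply: ler_sum => k _; apply: fg; exact: mem_qmc_point.
  by rewrite sumr_const card_ord mulr_natl.
rewrite normcN !cube_integralE.
have -> : complex_integral (cube_measure R d) (cut f) -
    complex_integral (cube_measure R d) (cut g) =
    complex_integral (cube_measure R d) (fun x => cut f x - cut g x).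
  transitivity (complex_integral (cube_measure R d) (cut f) +
    complex_integral (cube_measure R d) (fun x => -1 * cut g x)).
    by rewrite complex_integralZ// mulN1r.
  rewrite -complex_integralD//.
    by congr complex_integral; apply/funext => x; rewrite mulN1r.
  by apply: bounded_measurableM => //; exact: bounded_measurable_cst.
rewrite mulr2n; apply: le_normc_complex_integral; last exact: cutB.
rewrite (_ : (fun _ => _) = (fun x => cut f x + -1 * cut g x)).
  apply: bounded_measurableD => //.
  by apply: bounded_measurableM => //; exact: bounded_measurable_cst.
by apply/funext => x; rewrite mulN1r.
Qed.

(** The basis functions have modulus 1, so the remainder is bounded by the tail
    of the coefficients at every point at once. *)
Lemma partial_sum_approx (c : d.-tuple (freq S) -> R[i]) f :
  (\esum_(h in setT) (normc (c h))%:E < +oo)%E ->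
  (forall x, x \in @cube R d -> has_sum (fun h => c h * Defs.basis h x) (f x)) ->
  forall e : R, 0 < e -> exists A, forall x, x \in @cube R d ->
    normc (f x - partial_sum c A x) <= e.
Proof.
move=> summ fsum e e0; have e20 : 0 < e / 2 by rewrite divr_gt0.
have [|A tail] := esum_fsubsum_approx e20 _ summ.
  by move=> h; rewrite lee_fin normc_ge0.
exists A => x /fsum /(_ _ e20)[B fB].
pose C := (A `|` B)%fset.
have AC : (A `<=` C)%fset by exact: fsubsetUl.
have -> : f x - partial_sum c A x =
    - (partial_sum c C x - f x) + (partial_sum c C x - partial_sum c A x) by ring.
rewrite [e]splitr; apply: le_trans (le_normc_add _ _) _; apply: lerD.
  by rewrite normcN; apply/ltW/fB; exact: fsubsetUr.
rewrite /partial_sum (bigID (mem A)) /=.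
rewrite (big_fset_sub (fun h => c h * Defs.basis h x) AC) addrAC subrr add0r.
apply: le_trans (le_normc_sum _ _ _) _.
have := tail _ AC; rewrite sumEFin lee_fin; apply: le_trans.
apply: ler_sum => h _; rewrite normcM (basis_prod HS) normc_prod big1 ?mulr1//.
by move=> j _; rewrite (normc_phi HS).
Qed.

Lemma le_quadrature_error z (c : d.-tuple (freq S) -> R[i]) f (M : R) :
  (\esum_(h in setT) (normc (c h))%:E < +oo)%E ->
  (forall x, x \in @cube R d -> has_sum (fun h => c h * Defs.basis h x) (f x)) ->
  (forall A : {fset d.-tuple (freq S)},
     \sum_(h <- A | (h != zero_freq S d) && in_dual z h) normc (c h) <= M) ->
  normc (quadrature_error z f) <= M.
Proof.
move=> summ fsum cM; apply/ler_addgt0Pr => e e0.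
have approx := partial_sum_approx summ fsum.
have [|A fA] := approx (e / 3); first by rewrite divr_gt0.
apply: (le_trans (@quadrature_error_uniform z f (partial_sum c A) (e / 3) _ _ fA)).
- exact: bounded_measurable_partial_sum.
- move=> e' /approx[B fB]; exists (partial_sum c B) => //.
  exact: bounded_measurable_partial_sum.
apply: lerD; last by rewrite -[_ *+ _]mulr_natr divfK.
rewrite quadrature_error_partial_sum.
exact: le_trans (le_normc_sum _ _ _) (cM A).
Qed.

End QuadratureError.

(** * Powers, finite supports and a finite Hoelder inequality *)


Section ExtendedPowers.
Variable R : realType.
Local Open Scope ereal_scope.

Lemma le_poweR (x y : \bar R) (a : R) : (0 <= a)%R -> 0 <= x -> x <= y ->
  x `^ a <= y `^ a.
Proof.
move=> a0 x0 xy; apply: gt0_ler_poweR => //; rewrite in_itv /= ?x0 ?leey//.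
by rewrite (le_trans x0 xy) ?leey.
Qed.

Lemma poweRK (x : \bar R) (a : R) : (0 < a)%R -> 0 <= x -> (x `^ a) `^ a^-1 = x.
Proof. by move=> a0 x0; rewrite -poweRrM mulfV ?gt_eqF// poweRe1. Qed.

Lemma poweRVK (x : \bar R) (a : R) : (0 < a)%R -> 0 <= x -> (x `^ a^-1) `^ a = x.
Proof. by move=> a0 x0; rewrite -poweRrM mulVf ?gt_eqF// poweRe1. Qed.

Lemma esum_finite_support (I : choiceType) (D : set I) (a : I -> \bar R)
    (A : {fset I}) : (forall i, 0 <= a i) -> (forall i, i \in A -> D i) ->
  (forall i, i \notin A -> a i = 0) ->
  \esum_(i in D) a i = \sum_(i <- A) a i.
Proof.
move=> a0 AD aA; apply/eqP; rewrite eq_le fsubsum_le_esum// andbT.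
apply: esum_le_fsubsums => B _.
rewrite (bigID (mem A)) /= [X in _ + X]big1 ?adde0 => [|i /aA//].
rewrite [leRHS](bigID (mem B)) /= -[leLHS]adde0 leeD ?sume_ge0//.
rewrite le_eqVlt; apply/orP; left; apply/eqP.
rewrite [LHS]big_fset_condE [RHS]big_fset_condE; apply: eq_fbigl => i; rewrite !inE /=.
by rewrite andbC.
Qed.

End ExtendedPowers.

Section FiniteHoelder.
Variable R : realType.

(** Normalising the right factor, the claim is Young's inequality summed. *)
Lemma hoelder_dual_bound (I : Type) (s : seq I) (t w : I -> R) (p q : R) :
  0 < p -> 0 < q -> p^-1 + q^-1 = 1 ->
  (forall i, 0 <= t i) -> (forall i, 0 <= w i) ->
  \sum_(i <- s) t i `^ p <= 1 ->
  \sum_(i <- s) t i * w i <= (\sum_(i <- s) w i `^ q) `^ q^-1.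
Proof.
move=> p0 q0 pq t0 w0 t1.
have scaled (K : R) : 0 < K -> \sum_(i <- s) w i `^ q <= K `^ q ->
    \sum_(i <- s) t i * w i <= K.
  move=> K0 wK.
  apply: (@le_trans _ _ (\sum_(i <- s) K * (t i `^ p / p + (w i / K) `^ q / q))).
    apply: ler_sum => i _; rewrite -[X in X <= _](mulfVK (lt0r_neq0 K0)).
    rewrite [_ / K * K]mulrC ler_pM2l// -mulrA conjugate_powR//.
    by rewrite divr_ge0// ltW.
  rewrite -mulr_sumr big_split /= -!mulr_suml -[leRHS]mulr1 ler_pM2l// -pq.
  apply: lerD; rewrite -[leRHS]mul1r ler_pM2r ?invr_gt0//.
  under eq_bigr do rewrite powRM ?invr_ge0 ?(ltW K0)//.
  rewrite -mulr_suml -powR_inv1 ?(ltW K0)// powRAC powR_inv1 ?powR_ge0//.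
  by rewrite ler_pdivrMr ?mul1r// powR_gt0.
set M := \sum_(i <- s) w i `^ q.
have M0 : 0 <= M by apply: sumr_ge0 => i _; exact: powR_ge0.
apply/ler_addgt0Pr => e e0; apply: scaled.
  by rewrite ltr_wpDl// powR_ge0.
rewrite -/M -[leLHS]powRr1// -(mulVf (lt0r_neq0 q0)) powRrM.
apply: ge0_ler_powR; rewrite ?nnegrE ?addr_ge0 ?powR_ge0//; try exact: ltW.
by rewrite lerDl ltW.
Qed.
End FiniteHoelder.

(** * Coefficients of the unit ball *)


Lemma conj_exponent_spec (R : realType) (p : \bar R) : (1 < p)%E ->
  (p = +oo%E /\ conj_exponent p = 1) \/
  (exists p' : R, [/\ p = p'%:E, 0 < p', 0 < conj_exponent p &
     p'^-1 + (conj_exponent p)^-1 = 1]).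
Proof.
case: p => [p'|_|//]; last by left.
rewrite lte_fin => p1; right; exists p' => /=.
have p0 : 0 < p' by exact: lt_trans ltr01 p1.
split=> //; first by rewrite divr_gt0// subr_gt0.
have pn0 : p' != 0 by rewrite gt_eqF.
have pn1 : p' - 1 != 0 by rewrite subr_eq0 gt_eqF.
by field; rewrite ?pn0 ?pn1.
Qed.

Lemma conj_exponent_gt0 (R : realType) (p : \bar R) : (1 < p)%E ->
  0 < conj_exponent p.
Proof. by move=> /conj_exponent_spec[[_ ->]|[p' [_ _ ]]]. Qed.

Section Weights.
Variables (R : realType) (S : qmc_rule R).
Variables (gamma : {fset nat} -> R) (r : freq S -> R).
Hypotheses (gamma0 : forall u, 0 <= gamma u) (r0 : forall h, 0 < r h).

(** The reciprocal of the decay function; unlike the latter it is always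
    finite, vanishing where the weight does. *)
Definition coef_weight d (h : d.-tuple (freq S)) : R :=
  gamma (labels (supp h)) `^ 2^-1 / decay_prod r h.

Lemma decay_prod_gt0 d (h : d.-tuple (freq S)) : 0 < decay_prod r h.
Proof. by apply: prodr_gt0 => j _; exact: r0. Qed.

Lemma coef_weight_ge0 d (h : d.-tuple (freq S)) : 0 <= coef_weight h.
Proof. by rewrite divr_ge0 ?powR_ge0// ltW// decay_prod_gt0. Qed.

Lemma decay_cases d (h : d.-tuple (freq S)) :
  (coef_weight h = 0 /\ decay gamma r h = +oo%E) \/
  (0 < coef_weight h /\ decay gamma r h = (coef_weight h)^-1%:E).
Proof.
rewrite /decay /coef_weight; case: eqVneq => [->|g0]; [left|right].
  by rewrite powR0 ?invr_eq0// mul0r.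
have gp : 0 < gamma (labels (supp h)) by rewrite lt_neqAle eq_sym g0 gamma0.
split; first by rewrite divr_gt0 ?powR_gt0// decay_prod_gt0.
by rewrite powRN invfM invrK.
Qed.

Section Holder.
Variables (p : \bar R) (d : nat).
Hypothesis p1 : (1 < p)%E.
Local Notation q := (conj_exponent p).
Implicit Types (c : d.-tuple (freq S) -> R[i]).

(** Where the weight vanishes, the decay function is infinite and the norm bound
    forces c h = 0; hence c factors through coef_weight. *)
Lemma coef_norm_le1_finite (p' : R) c : 0 < p' -> (coef_norm p'%:E gamma r c <= 1)%E ->
  exists t : d.-tuple (freq S) -> R,
    [/\ forall h, 0 <= t h,
        forall h, h != zero_freq S d -> normc (c h) = t h * coef_weight h &
        forall A : {fset d.-tuple (freq S)},
          (forall h, h \in A -> h != zero_freq S d) ->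
          \sum_(h <- A) t h `^ p' <= 1].
Proof.
move=> p0 cn1.
pose term h := ((normc (c h))%:E * decay gamma r h)%E.
pose E := (\esum_(h in [set h | h != zero_freq S d]) term h `^ p')%E.
have cn : (E `^ p'^-1 <= 1)%E by exact: cn1.
have term0 h : (0 <= term h)%E.
  rewrite /term; case: (decay_cases h) => -[w0 ->].
    by rewrite mule_ge0 ?lee_fin ?normc_ge0.
  by rewrite -EFinM lee_fin mulr_ge0 ?normc_ge0// invr_ge0 ltW.
have E1 : (E <= 1)%E.
  have E0 : (0 <= E)%E by apply: esum_ge0 => h _; exact: poweR_ge0.
  rewrite -(poweRVK p0 E0) -[leRHS](poweR1r p').
  by apply: le_poweR => //; [exact: ltW|exact: poweR_ge0].
have sub1 (A : {fset d.-tuple (freq S)}) :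
    (forall h, h \in A -> h != zero_freq S d) ->
    (\sum_(h <- A) term h `^ p' <= 1)%E.
  by move=> A0; apply: le_trans E1; apply: fsubsum_le_esum => // h _; exact: poweR_ge0.
exists (fun h => normc (c h) / coef_weight h); split.
- by move=> h; rewrite divr_ge0 ?normc_ge0 ?coef_weight_ge0.
- move=> h h0; case: (decay_cases h) => -[w0 dE]; last by rewrite divfK// gt_eqF.
  rewrite w0 mulr0; apply/eqP; apply: contraT => c0.
  have := sub1 [fset h]%fset; rewrite big_seq_fset1 => /(_ _)/wrap[].
    by move=> h'; rewrite inE => /eqP ->.
  rewrite /term dE gt0_muley ?lte_fin ?lt_neqAle ?normc_ge0 1?eq_sym ?c0//.
  by rewrite poweRyr ?gt_eqF.
- move=> A A0; rewrite -lee_fin -sumEFin; apply: le_trans (sub1 A A0).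
  apply: lee_sum => h _; rewrite -poweR_EFin; apply: le_poweR.
  + exact: ltW.
  + by rewrite lee_fin divr_ge0 ?normc_ge0 ?coef_weight_ge0.
  + rewrite /term; case: (decay_cases h) => -[w0 ->]; last by rewrite EFinM.
    by rewrite w0 invr0 mulr0 mule_ge0 ?lee_fin ?normc_ge0.
Qed.

(** Writing |c h| as t h * coef_weight h, with t bounded by the norm of c,
    Hoelder's inequality separates the coefficients from the weights. *)
Lemma sum_coef_le c (A : {fset d.-tuple (freq S)}) :
  (coef_norm p gamma r c <= 1)%E -> (forall h, h \in A -> h != zero_freq S d) ->
  \sum_(h <- A) normc (c h) <= (\sum_(h <- A) coef_weight h `^ q) `^ q^-1.
Proof.
case: (conj_exponent_spec p1) => [[pE qE]|[p' [pE p0 q0 pq]]].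
  rewrite qE invr1 pE /coef_norm => cn A0.
  rewrite powRr1; last by apply: sumr_ge0 => h _; exact: powR_ge0.
  rewrite [leLHS]big_seq [leRHS]big_seq; apply: ler_sum => h hA.
  rewrite powRr1 ?coef_weight_ge0//.
  have : ((normc (c h))%:E * decay gamma r h <= 1)%E.
    by apply: le_trans cn; apply: ereal_sup_ubound; exists h => //; exact: A0.
  case: (decay_cases h) => -[w0 ->].
    rewrite w0; case: ltgtP (normc_ge0 (c h)) => // c0 _.
    by rewrite gt0_muley ?lte_fin.
  by rewrite -EFinM lee_fin ler_pdivrMr// mul1r.
rewrite {1}pE => /(coef_norm_le1_finite p0)[t [t0 tE tA]] A0.
have -> : \sum_(h <- A) normc (c h) = \sum_(h <- A) t h * coef_weight h.
  by rewrite big_seq [RHS]big_seq; apply: eq_bigr => h hA; rewrite tE// A0.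
apply: (hoelder_dual_bound p0 q0 pq t0) => //; last exact: tA.
by move=> h; exact: coef_weight_ge0.
Qed.

End Holder.
End Weights.

(** * The worst-case error as a sum over the dual *)


Section ErrorFormula.
Variables (R : realType) (S : qmc_rule R) (phi : freq S -> R -> R[i]).
Hypothesis HS : character_rule phi.
Variables (gamma : {fset nat} -> R) (r : freq S -> R) (p : \bar R) (d : nat).
Hypotheses (gamma0 : forall u, 0 <= gamma u) (r0 : forall h, 0 < r h).
Hypothesis p1 : (1 < p)%E.
Local Notation q := (conj_exponent p).
Local Notation w := (@coef_weight R S gamma r d).

Let q0 : 0 < q. Proof. exact: conj_exponent_gt0. Qed.
Let w0 h : 0 <= w h. Proof. exact: coef_weight_ge0. Qed.

Section Extremal.
Variable A : {fset d.-tuple (freq S)}.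
Hypothesis A0 : forall h, h \in A -> h != zero_freq S d.
Let M : R := \sum_(h <- A) w h `^ q.
Let M0 : 0 <= M. Proof. by apply: sumr_ge0 => h _; exact: powR_ge0. Qed.

(** The case of equality in Hoelder's inequality over A; for q = 1 the second
    factor is 1, so the same formula serves p = +oo. *)
Definition extremal_coef (h : d.-tuple (freq S)) : R :=
  if h \in A then w h `^ q * M `^ (q^-1 - 1) else 0.

Lemma extremal_coef_ge0 h : 0 <= extremal_coef h.
Proof. by rewrite /extremal_coef; case: ifP => // _; rewrite mulr_ge0 ?powR_ge0. Qed.

Lemma sum_extremal_coef : \sum_(h <- A) extremal_coef h = M `^ q^-1.
Proof.
rewrite big_seq (eq_bigr (fun h => w h `^ q * M `^ (q^-1 - 1))); last first.
  by move=> h hA; rewrite /extremal_coef hA.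
rewrite -big_seq -mulr_suml -/M; have [->|Mn0] := eqVneq M 0.
  by rewrite mul0r powR0// invr_eq0 gt_eqF.
by rewrite -{1}[M]powRr1// -powRD ?Mn0 ?implybT//; congr (_ `^ _); ring.
Qed.

Lemma extremal_coef_norm :
  (coef_norm p gamma r (fun h => ((extremal_coef h)%:C)%C) <= 1)%E.
Proof.
case: (conj_exponent_spec p1) => [[pE qE]|[p' [pE p0 _ pq]]].
  rewrite pE /coef_norm; apply: ge_ereal_sup => _ [h _ <-].
  rewrite normc_real ?extremal_coef_ge0//.
  rewrite /extremal_coef qE invr1 subrr powRr0 mulr1 powRr1//.
  case: ifP => _; last by rewrite mul0e.
  case: (decay_cases gamma0 r0 h) => -[wh ->]; first by rewrite wh mul0e.
  by rewrite -EFinM mulfV ?gt_eqF.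
(* The p'-th power of a term of the norm is at most w h `^ q / M on A. *)
rewrite {1}pE /coef_norm -[leRHS](poweR1r p'^-1); apply: le_poweR.
- by rewrite invr_ge0 ltW.
- by apply: esum_ge0 => h _; exact: poweR_ge0.
pose b h := ((if h \in A then w h `^ q * M^-1 else 0)%:E)%E.
apply: (@le_trans _ _ (\esum_(h in [set h | h != zero_freq S d]) b h)%E).
  apply: le_esum => h _.
  rewrite normc_real ?extremal_coef_ge0// /extremal_coef /b.
  case: ifPn => hA; last by rewrite mul0e poweR0r ?gt_eqF.
  case: (decay_cases gamma0 r0 h) => -[wh ->].
    by rewrite wh powR0 ?gt_eqF// !mul0r mul0e poweR0r ?gt_eqF.
  have Mp : 0 < M.
    rewrite /M (bigD1_seq h)//= ltr_pwDl ?powR_gt0//.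
    by apply: sumr_ge0 => i _; exact: powR_ge0.
  rewrite -EFinM poweR_EFin lee_fin -(powR_inv1 (ltW wh)).
  rewrite (powRM _ (mulr_ge0 (powR_ge0 _ _) (powR_ge0 _ _)) (powR_ge0 _ _)).
  rewrite (powRM _ (powR_ge0 _ _) (powR_ge0 _ _)) -!powRrM mulrAC -powRD; last first.
    by rewrite (gt_eqF wh) implybT.
  have qE : q^-1 = 1 - p'^-1 by rewrite -pq; ring.
  have -> : (q^-1 - 1) * p' = -1.
    by rewrite qE; field; rewrite gt_eqF.
  have -> : q * p' + -1 * p' = q.
    have pn : p' != 0 by rewrite gt_eqF.
    have qn : q != 0 by rewrite gt_eqF.
    have : (p'^-1 + q^-1) * (q * p') = q * p' by rewrite pq mul1r.
    have -> : (p'^-1 + q^-1) * (q * p') = q + p' by field; rewrite pn qn.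
    by move=> <-; ring.
  by rewrite powR_inv1 ?(ltW Mp).
rewrite (esum_finite_support (A := A)).
- rewrite /b sumEFin lee_fin big_seq (eq_bigr (fun h => w h `^ q * M^-1)).
    rewrite -big_seq -mulr_suml -/M.
    by have [->|Mn0] := eqVneq M 0; rewrite ?mul0r// mulfV.
  by move=> h ->.
- move=> h; rewrite /b lee_fin; case: ifP => // _.
  by rewrite mulr_ge0 ?powR_ge0// invr_ge0.
- exact: A0.
- by move=> h /negPf hA; rewrite /b hA.
Qed.

End Extremal.

Definition dual_sum z : \bar R :=
  \esum_(h in [set h | h != zero_freq S d /\ in_dual phi z h]) (w h `^ q)%:E.

Lemma dual_sum_ge0 z : (0 <= dual_sum z)%E.
Proof. by apply: esum_ge0 => h _; rewrite lee_fin powR_ge0. Qed.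

Lemma dual_sum_le_worst_case_error z :
  (dual_sum z `^ q^-1 <= worst_case_error p gamma r z)%E.
Proof.
set W := worst_case_error _ _ _ _.
have fin_le (A : {fset d.-tuple (freq S)}) :
    (forall h, h \in A -> h != zero_freq S d /\ in_dual phi z h) ->
    (((\sum_(h <- A) w h `^ q) `^ q^-1)%:E <= W)%E.
  move=> AD; have A0 h : h \in A -> h != zero_freq S d by move=> /AD[].
  pose c h : R[i] := ((extremal_coef A h)%:C)%C.
  have cA h : h \notin A -> c h = 0.
    by rewrite /c /extremal_coef => /negPf ->.
  apply: ereal_sup_ubound; exists (partial_sum c A); last first.
    congr EFin; rewrite -[X in normc X]/(quadrature_error z (partial_sum c A)).
    rewrite (quadrature_error_partial_sum HS) big_seq_cond.
    rewrite (eq_bigl (fun h => h \in A)) => [|h]; last first.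
      by apply/andP/idP => [[]//|hA]; split => //; apply/andP; exact: AD.
    rewrite -big_seq /c -(rmorph_sum (@real_complex R)) sum_extremal_coef.
    by rewrite normc_real ?powR_ge0.
  exists c; split.
  - rewrite (esum_finite_support (A := A))// => [|h|h /cA ->].
    + by rewrite sumEFin ltry.
    + by rewrite lee_fin normc_ge0.
    + by rewrite normc0.
  - move=> x _ e e0; exists A => B AB.
    rewrite /partial_sum (big_fset_incl _ AB) ?subrr ?normc0// => h _ /cA ->.
    by rewrite mul0r.
  - exact: extremal_coef_norm.
have W0 : (0 <= W)%E.
  apply: (@le_trans _ _ _ _ _ _ (fin_le fset0 _)) => [|h]; last by rewrite inE.
  by rewrite lee_fin powR_ge0.
rewrite -[leRHS](poweRK q0 W0); apply: le_poweR.
- by rewrite invr_ge0 ltW.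
- exact: dual_sum_ge0.
apply: esum_le_fsubsums => A AD; rewrite sumEFin.
have S0 : (0 <= (\sum_(h <- A) w h `^ q)%:E)%E.
  by rewrite lee_fin; apply: sumr_ge0 => h _; exact: powR_ge0.
rewrite -[leLHS](poweRVK q0 S0); apply: le_poweR; first exact: ltW.
  exact: poweR_ge0.
by rewrite poweR_EFin; exact: fin_le.
Qed.

Lemma worst_case_error_le_dual_sum z :
  (worst_case_error p gamma r z <= dual_sum z `^ q^-1)%E.
Proof.
apply: ge_ereal_sup => _ [f [c [summ fsum cn]] <-].
have := dual_sum_ge0 z; case Ez: (dual_sum z) => [E| |//] E0; last first.
  by rewrite poweRyr ?leey// invr_eq0 gt_eqF.
rewrite poweR_EFin lee_fin.
apply: (le_quadrature_error HS summ fsum) => A; rewrite big_fset_condE.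
apply: (le_trans (sum_coef_le gamma0 r0 p1 cn _)).
  by move=> h; rewrite !inE => /andP[_ /andP[]].
apply: ge0_ler_powR; rewrite ?invr_ge0 ?(ltW q0)// ?nnegrE//.
  by apply: sumr_ge0 => h _; exact: powR_ge0.
rewrite -lee_fin -sumEFin -Ez; apply: fsubsum_le_esum => [h _|h].
  by rewrite lee_fin powR_ge0.
by rewrite !inE => /andP[_ /andP[]].
Qed.

(** The upper bound is Hoelder's inequality; extremal functions of larger and
    larger finite subsets of the dual attain it in the limit, also when the sum
    is infinite. *)
Lemma worst_case_errorE z : worst_case_error p gamma r z = (dual_sum z `^ q^-1)%E.
Proof.
apply/eqP; rewrite eq_le worst_case_error_le_dual_sum.
exact: dual_sum_le_worst_case_error.
Qed.

End ErrorFormula.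

(** * Subadditivity of powers and averaging *)


Section Subadditivity.
Variable R : realType.

(** For u <= x + y, the ratio u / (x + y) lies in [0, 1], where a power with
    exponent at most 1 dominates the identity; apply this to x and y. *)
Lemma powR_subadditive (x y a : R) : 0 <= x -> 0 <= y -> 0 < a <= 1 ->
  (x + y) `^ a <= x `^ a + y `^ a.
Proof.
move=> x0 y0 /andP[a0 a1].
have [xy0|xyn0] := eqVneq (x + y) 0.
  by rewrite xy0 powR0 ?gt_eqF// addr_ge0 ?powR_ge0.
have xyp : 0 < x + y by rewrite lt_neqAle eq_sym xyn0 addr_ge0.
have part (u : R) : 0 <= u -> u <= x + y ->
    u / (x + y) * (x + y) `^ a <= u `^ a.
  move=> u0 uxy; have [->|un0] := eqVneq u 0; first by rewrite !mul0r powR_ge0.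
  have up : 0 < u by rewrite lt_neqAle eq_sym un0.
  rewrite -[in leRHS](divfK xyn0 u) powRM ?(ltW xyp)//; last by rewrite divr_ge0// ltW.
  rewrite ler_wpM2r ?powR_ge0//; apply: ger1_powR => //.
  by rewrite divr_gt0//= ler_pdivrMr// mul1r.
have := lerD (part x x0 _) (part y y0 _); rewrite lerDl lerDr => /(_ y0 x0).
by rewrite -mulrDl -mulrDl mulfV// mul1r.
Qed.

Lemma powR_sum_subadditive (I : Type) (s : seq I) (F : I -> R) (a : R) :
  (forall i, 0 <= F i) -> 0 < a <= 1 ->
  (\sum_(i <- s) F i) `^ a <= \sum_(i <- s) F i `^ a.
Proof.
move=> F0 a01; elim: s => [|i s IH].
  by rewrite !big_nil powR0// gt_eqF//; case/andP: a01.
rewrite !big_cons; apply: le_trans (powR_subadditive _ _ a01) _ => //.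
  by apply: sumr_ge0.
by rewrite lerD2l.
Qed.

Local Open Scope ereal_scope.

Lemma poweR_subadditive (x y : \bar R) (a : R) : 0 <= x -> 0 <= y ->
  (0 < a <= 1)%R -> (x + y) `^ a <= x `^ a + y `^ a.
Proof.
move=> x0 y0 a01; have an0 : a != 0%R by rewrite gt_eqF//; case/andP: a01.
case: x y x0 y0 => [x| |] [y| |]//; rewrite ?lee_fin => x0 y0.
- exact: powR_subadditive.
- by rewrite !poweRyr// addeC /= leey.
- by rewrite !poweRyr// /= leey.
- by rewrite !poweRyr// /= leey.
Qed.

Lemma poweR_esum_subadditive (I : choiceType) (D : set I) (F : I -> R) (a : R) :
  (forall i, 0 <= F i)%R -> (0 < a <= 1)%R ->
  (\esum_(i in D) (F i)%:E) `^ a <= \esum_(i in D) (F i `^ a)%:E.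
Proof.
move=> F0 a01; have a0 : (0 < a)%R by case/andP: a01.
set Y := esum _ (fun i => (F i `^ a)%:E).
have Y0 : 0 <= Y by apply: esum_ge0 => i _; rewrite lee_fin powR_ge0.
rewrite -[leRHS](poweRVK a0 Y0); apply: le_poweR; first exact: ltW.
  by apply: esum_ge0 => i _; rewrite lee_fin.
apply: esum_le_fsubsums => A AD; rewrite sumEFin.
have S0 : 0 <= (\sum_(i <- A) F i)%:E by rewrite lee_fin sumr_ge0.
rewrite -[leLHS](poweRK a0 S0); apply: le_poweR.
- by rewrite invr_ge0 ltW.
- exact: poweR_ge0.
rewrite poweR_EFin; apply: (@le_trans _ _ (\sum_(i <- A) (F i `^ a)%:E)).
  by rewrite sumEFin lee_fin powR_sum_subadditive.
by apply: fsubsum_le_esum => // i _; rewrite lee_fin powR_ge0.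
Qed.

Lemma sum_const_ereal (I : finType) (x : \bar R) : 0 <= x ->
  \sum_(i : I) x = (#|I|%:R)%:E * x.
Proof.
move=> x0; rewrite cardT -big_enum /=; elim: (enum I) => [|i s IH].
  by rewrite big_nil mul0e.
by rewrite big_cons IH /= -nat1r EFinD ge0_muleDl ?mul1e ?lee_fin.
Qed.

Lemma exists_le_average (G : finType) (theta : G -> \bar R) (c : \bar R) :
  (0 < #|G|)%N -> (forall g, 0 <= theta g) ->
  \sum_(g : G) theta g <= (#|G|%:R)%:E * c ->
  exists g, theta g <= c.
Proof.
move=> G0 theta0 sc; have [g0 _] := card_gt0P G0.
have [g _ gmin] :=
  Order.TotalTheory.arg_minP (P := xpredT) (fun g => theta g) (erefl true : xpredT g0).
exists g; have : (#|G|%:R)%:E * theta g <= (#|G|%:R)%:E * c.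
  apply: le_trans sc; rewrite -sum_const_ereal//.
  by apply: lee_sum => h _; exact: gmin.
by rewrite lee_pmul2l// lte_fin ltr0n.
Qed.

End Subadditivity.

(** * Splitting off the last component *)


Section Snoc.
Variables (T : Type) (d : nat).
Implicit Types (t : d.-tuple T) (x : T).

Definition snoc t x : d.+1.-tuple T := [tuple of rcons t x].

Lemma lift_max_widen (i : 'I_d) : lift ord_max i = widen_ord (leqnSn d) i.
Proof. exact/val_inj/lift_max. Qed.

Lemma tnth_snoc_widen t x (i : 'I_d) :
  tnth (snoc t x) (widen_ord (leqnSn d) i) = tnth t i.
Proof. by rewrite !(tnth_nth x) /= nth_rcons size_tuple ltn_ord. Qed.

Lemma tnth_snoc_max t x : tnth (snoc t x) ord_max = x.
Proof. by rewrite (tnth_nth x) /= nth_rcons size_tuple ltnn eqxx. Qed.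

Lemma snoc_inj t1 t2 x1 x2 : snoc t1 x1 = snoc t2 x2 -> t1 = t2 /\ x1 = x2.
Proof.
move=> e; split; last by rewrite -(tnth_snoc_max t1 x1) e tnth_snoc_max.
by apply: eq_from_tnth => i; rewrite -(tnth_snoc_widen t1 x1) e tnth_snoc_widen.
Qed.

Definition init_tuple (h : d.+1.-tuple T) : d.-tuple T :=
  [tuple tnth h (widen_ord (leqnSn d) i) | i < d].

Lemma snoc_init (h : d.+1.-tuple T) : snoc (init_tuple h) (tnth h ord_max) = h.
Proof.
apply: eq_from_tnth => i; case: (unliftP ord_max i) => [j|] ->; last first.
  by rewrite tnth_snoc_max.
by rewrite lift_max_widen tnth_snoc_widen tnth_mktuple.
Qed.

Lemma init_snoc t x : init_tuple (snoc t x) = t.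
Proof. by case: (snoc_inj (snoc_init (snoc t x))). Qed.

End Snoc.

(** A sum over dimension d + 1 splits according to whether the last component
    vanishes; the first part is a sum over dimension d. *)
Lemma esum_snoc (R : realType) (V : nmodType) d (D : set (d.+1.-tuple V))
    (F : d.+1.-tuple V -> \bar R) : (forall h, (0 <= F h)%E) ->
  (\esum_(h in D) F h =
   \esum_(t in [set t : d.-tuple V | D (snoc t 0%R)]) F (snoc t 0%R) +
   \esum_(h in [set h | D h /\ tnth h ord_max != 0%R]) F h)%E.
Proof.
move=> F0; rewrite (esumID [set h | tnth h ord_max = 0]) => [|h _]; last exact: F0.
congr (_ + _)%E.
  apply: reindex_esum; split=> [t Dt|t t' _ _ e|h [Dh /= h0]].
  - by split => //=; rewrite tnth_snoc_max.
  - by case: (snoc_inj e).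
  - by exists (init_tuple h); rewrite /= -h0 snoc_init.
congr (\esum_(h in _) F h)%E; apply/seteqP; split=> h /= [Dh] /eqP h0; split=> //.
Qed.

Section LastComponent.
Variables (R : realType) (S : qmc_rule R) (phi : freq S -> R -> R[i]).
Hypothesis HS : character_rule phi.
Variables (gamma : {fset nat} -> R) (r : freq S -> R).
Hypothesis r0 : forall h, 0 < r h.
Variable d : nat.
Implicit Types (t : d.-tuple (freq S)) (z : d.-tuple (gen S)).
Local Notation w := (@coef_weight R S gamma r).
Local Notation N := (npoints S).

Lemma labels_suppP e (h : e.-tuple (freq S)) k :
  reflect (exists2 j : 'I_e, k = j.+1 & tnth h j != 0) (k \in labels (supp h)).
Proof.
rewrite /labels; apply: (iffP (imfsetP _ _ _ _)) => [[j /=]|[j -> hj]].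
  by rewrite inE => hj ->; exists j.
by exists j; rewrite //= inE.
Qed.

Lemma decay_prodE e (h : e.-tuple (freq S)) :
  decay_prod r h = \prod_(j < e) if tnth h j != 0 then r (tnth h j) else 1.
Proof. by rewrite /decay_prod big_mkcond; apply: eq_bigr => j _; rewrite inE. Qed.

Lemma decay_prod_snoc t l :
  decay_prod r (snoc t l) = decay_prod r t * (if l != 0 then r l else 1).
Proof.
rewrite !decay_prodE big_ord_recr tnth_snoc_max; congr (_ * _).
by apply: eq_bigr => j _; rewrite tnth_snoc_widen.
Qed.

Lemma coef_weight_snoc0 t : w (snoc t 0) = w t.
Proof.
rewrite /coef_weight decay_prod_snoc eqxx mulr1; congr (gamma _ `^ _ / _).
apply/fsetP => k; apply/labels_suppP/labels_suppP => -[j ->].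
  case: (unliftP ord_max j) => [i|] ->; last by rewrite tnth_snoc_max eqxx.
  by rewrite lift_max_widen tnth_snoc_widen; exists i.
by exists (widen_ord (leqnSn d) j); rewrite // tnth_snoc_widen.
Qed.

Lemma supp_snoc t l l' : l != 0 -> l' != 0 -> supp (snoc t l) = supp (snoc t l').
Proof.
move=> l0 l'0; apply/setP => j; rewrite !inE.
case: (unliftP ord_max j) => [i|] ->; last by rewrite !tnth_snoc_max l0 l'0.
by rewrite lift_max_widen !tnth_snoc_widen.
Qed.

Lemma average_snoc0 z g t : average phi (snoc z g) (snoc t 0) = average phi z t.
Proof.
rewrite /average; congr (_ * _); apply: eq_bigr => k _.
rewrite big_ord_recr /= !tnth_snoc_max (phi0 HS) mulr1.
by apply: eq_bigr => j _; rewrite !tnth_snoc_widen.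
Qed.

Lemma snoc_zero_freq t : (snoc t 0 == zero_freq S d.+1) = (t == zero_freq S d).
Proof.
apply/zero_freqP/zero_freqP => t0 j.
  by rewrite -(tnth_snoc_widen t 0) t0.
case: (unliftP ord_max j) => [i|] ->; last by rewrite tnth_snoc_max.
by rewrite lift_max_widen tnth_snoc_widen.
Qed.

(** For a last frequency that is no multiple of |G|, orthogonality in the last
    generator leaves only the node k = 0, so a fraction 1 / N of the generators
    puts the frequency in the dual. *)
Lemma count_in_dual z t l : (forall m, l <> m *+ #|gen S|) ->
  \sum_(g : gen S) ((in_dual phi (snoc z g) (snoc t l))%:R : R) =
  #|gen S|%:R / N%:R.
Proof.
move=> hl; have N0 := npoints_gt0 HS.
have sumC : \sum_g average phi (snoc z g) (snoc t l) =
    N%:R^-1 * ((\prod_(j < d) phi (tnth t j) (Defs.coord (tnth z j) 0)) * #|gen S|%:R).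
  rewrite -mulr_sumr; congr (_ * _); rewrite exchange_big /=.
  pose chi k := \prod_(j < d) phi (tnth t j) (Defs.coord (tnth z j) k).
  transitivity (\sum_(k < N) chi k * (if k == 0%N :> nat then #|gen S|%:R else 0)).
    apply: eq_bigr => k _; rewrite -(gen_sum HS (ltn_ord k) hl) mulr_sumr.
    apply: eq_bigr => g _; rewrite big_ord_recr /= !tnth_snoc_max; congr (_ * _).
    by apply: eq_bigr => j _; rewrite !tnth_snoc_widen.
  rewrite (bigD1 (Ordinal N0))//= big1 ?addr0// => k k0.
  by rewrite ifF ?mulr0//; apply: contra_neqF k0 => /eqP k0; apply/val_inj.
(* The phase left over from the node k = 0 disappears in the modulus, the
   left-hand side being a count. *)
have := congr1 (@normc R) sumC.
rewrite (eq_bigr _ (fun g _ => averageE HS (snoc z g) (snoc t l))).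
rewrite -natr_sum normc_nat natr_sum => ->.
have chi1 : normc (\prod_(j < d) phi (tnth t j) (Defs.coord (tnth z j) 0)) = 1.
  by rewrite normc_prod big1// => j _; exact: (normc_phi HS).
rewrite (normcM (N%:R^-1)) (normcM (\prod_(j < d) _)) chi1 mul1r.
by rewrite (normcV N%:R) (normc_nat R N) (normc_nat R #|gen S|) mulrC.
Qed.

End LastComponent.

(** * The greedy step and its iteration *)


Section EsumExtra.
Local Open Scope ereal_scope.
Context {R : realType} {I : choiceType}.

Lemma esum_scale_le (D : set I) (F : I -> R) (c : R) : (0 <= c)%R ->
  (forall i, 0 <= F i)%R ->
  \esum_(i in D) (c * F i)%:E <= c%:E * \esum_(i in D) (F i)%:E.
Proof.
move=> c0 F0; apply: esum_le_fsubsums => A AD.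
rewrite sumEFin -mulr_sumr EFinM lee_wpmul2l ?lee_fin//.
by rewrite -sumEFin; apply: fsubsum_le_esum => // i _; rewrite lee_fin.
Qed.

Lemma esum_subset_le (D E : set I) (F G : I -> \bar R) :
  (forall i, 0 <= F i) -> (forall i, 0 <= G i) ->
  (forall i, D i -> F i <= G i) -> D `<=` E ->
  \esum_(i in D) F i <= \esum_(i in E) G i.
Proof.
move=> F0 G0 FG DE; rewrite esum_mkcond [leRHS]esum_mkcond; apply: le_esum => i _.
case: ifPn => [|_]; last by case: ifP.
by rewrite inE => Di; rewrite ifT ?inE; [exact: FG|exact: DE].
Qed.

End EsumExtra.

Section GreedyStep.
Variables (R : realType) (S : qmc_rule R) (phi : freq S -> R -> R[i]).
Hypothesis HS : character_rule phi.
Variables (gamma : {fset nat} -> R) (r : freq S -> R) (p : \bar R).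
Hypotheses (gamma0 : forall u, 0 <= gamma u) (r0 : forall h, 0 < r h).
Hypothesis p1 : (1 < p)%E.
Variables (alpha lambda : R).
Local Notation q := (conj_exponent p).
Local Notation w := (@coef_weight R S gamma r).
Local Notation N := (npoints S).
Local Notation e := (q / lambda).
Hypothesis growth : forall h : freq S, h != 0 ->
  N%:R `^ alpha * r h <= r (h *+ #|gen S|).
Hypotheses (lambda1 : 1 <= lambda) (lambda_lt : lambda < alpha * q).

Let q0 : 0 < q. Proof. exact: conj_exponent_gt0. Qed.
Let l0 : 0 < lambda. Proof. exact: lt_le_trans ltr01 lambda1. Qed.
Let e0 : 0 < e. Proof. by rewrite divr_gt0. Qed.
Let N0 : 0 < N%:R :> R. Proof. by rewrite ltr0n (npoints_gt0 HS). Qed.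
Let w0 d (h : d.-tuple (freq S)) : 0 <= w h. Proof. exact: coef_weight_ge0. Qed.
Let lV01 : 0 < lambda^-1 <= 1. Proof. by rewrite invr_gt0 l0 invf_le1. Qed.

Lemma mulrn_card_gen_neq0 (l : freq S) : l != 0 -> l *+ #|gen S| != 0.
Proof.
apply: contraNneq => lG; apply/eqP/(mul_card_gen_inj HS).
by rewrite /= lG mul0rn.
Qed.

(** The exponent alpha * q / lambda exceeds 1: this is where lambda < alpha * q
    is needed. *)
Lemma coef_weight_dilate d (t : d.-tuple (freq S)) l : l != 0 ->
  w (snoc t (l *+ #|gen S|)) `^ e <= N%:R^-1 * w (snoc t l) `^ e.
Proof.
move=> ln0; have lGn0 := mulrn_card_gen_neq0 ln0.
have wle : w (snoc t (l *+ #|gen S|)) <= N%:R `^ (- alpha) * w (snoc t l).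
  rewrite /coef_weight (supp_snoc t lGn0 ln0) !decay_prod_snoc ln0 lGn0.
  rewrite mulrCA ler_wpM2l ?powR_ge0// powRN -invfM.
  have D0 := decay_prod_gt0 r0 t.
  rewrite lef_pV2 ?posrE ?mulr_gt0 ?powR_gt0//.
  by rewrite mulrCA ler_pM2l// growth.
apply: (@le_trans _ _ ((N%:R `^ (- alpha) * w (snoc t l)) `^ e)).
  by apply: ge0_ler_powR; rewrite ?nnegrE ?(ltW e0)// mulr_ge0 ?powR_ge0.
rewrite powRM ?powR_ge0// ler_wpM2r ?powR_ge0// -powRrM -(powR_inv1 (ltW N0)).
apply: ler_powR; first by rewrite ler1n (npoints_gt0 HS).
rewrite mulNr lerN2 mulrA ler_pdivlMr// mul1r; exact: ltW.
Qed.

Section Step.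
Variables (d : nat) (z : d.-tuple (gen S)).

Definition last_sum : \bar R :=
  \esum_(h in [set h : d.+1.-tuple (freq S) | tnth h ord_max != 0]) (w h `^ e)%:E.

Definition last_dual_sum (g : gen S) : \bar R :=
  \esum_(h in [set h : d.+1.-tuple (freq S) | tnth h ord_max != 0])
    (w h `^ e * (in_dual phi (snoc z g) h)%:R)%:E.

Lemma last_dual_sum_ge0 g : (0 <= last_dual_sum g)%E.
Proof. by apply: esum_ge0 => h _; rewrite lee_fin mulr_ge0 ?powR_ge0. Qed.

(** The power 1 / lambda is subadditive, and turns w ^ q into w ^ (q / lambda). *)
Lemma dual_sum_snoc g :
  (dual_sum phi gamma r p (snoc z g) `^ lambda^-1 <=
   dual_sum phi gamma r p z `^ lambda^-1 + last_dual_sum g)%E.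
Proof.
have wq0 n (h : n.-tuple (freq S)) : (0 <= (w h `^ q)%:E)%E.
  by rewrite lee_fin powR_ge0.
rewrite {1}/dual_sum esum_snoc; last exact: wq0.
apply: le_trans (poweR_subadditive _ _ lV01) _.
- by apply: esum_ge0 => h _; exact: wq0.
- by apply: esum_ge0 => h _; exact: wq0.
apply: leeD.
  rewrite le_eqVlt; apply/orP; left; apply/eqP; congr (_ `^ _)%E.
  rewrite /dual_sum; under eq_esum do rewrite coef_weight_snoc0.
  congr (\esum_(h in _) _)%E; apply/seteqP; split=> t /=;
    by rewrite snoc_zero_freq /in_dual average_snoc0.
apply: le_trans (poweR_esum_subadditive _ _ lV01) _.
  by move=> h; exact: powR_ge0.
apply: esum_subset_le => h.
- by rewrite lee_fin powR_ge0.
- by rewrite lee_fin mulr_ge0 ?powR_ge0.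
- by move=> [[_ ->] _]; rewrite mulr1 -powRrM.
- by move=> [].
Qed.

(** Frequencies with last component outside the multiples of |G| are counted
    |G| / N times; the multiples, counted at most |G| times, are dilations of
    arbitrary non-zero components, which costs a factor 1 / N as well. *)
Lemma sum_last_dual_sum :
  (\sum_(g : gen S) last_dual_sum g <= (#|gen S|%:R)%:E * ((2 / N%:R)%:E * last_sum))%E.
Proof.
rewrite /last_dual_sum -esum_sum; last first.
  by move=> h g _ _; rewrite lee_fin mulr_ge0 ?powR_ge0.
pose G : R := #|gen S|%:R; have G0 : 0 <= G by exact: ler0n.
pose F (h : d.+1.-tuple (freq S)) : R :=
  w h `^ e * \sum_g (in_dual phi (snoc z g) h)%:R.
have F0 h : 0 <= F h.
  by rewrite mulr_ge0 ?powR_ge0//; apply: sumr_ge0 => g _; exact: ler0n.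
rewrite (eq_esum (b := fun h => (F h)%:E)); last first.
  by move=> h _; rewrite sumEFin -mulr_sumr.
pose M := [set h : d.+1.-tuple (freq S) | exists m, tnth h ord_max = m *+ #|gen S|].
rewrite (esumID M); last by move=> h _; rewrite lee_fin.
have cT : (\esum_(h in [set h : d.+1.-tuple (freq S) | tnth h ord_max != 0%R])
    (G / N%:R * w h `^ e)%:E <= (G / N%:R)%:E * last_sum)%E.
  apply: esum_scale_le => [|h]; last exact: powR_ge0.
  by rewrite divr_ge0.
have -> : ((#|gen S|%:R)%:E * ((2 / N%:R)%:E * last_sum) =
    (G / N%:R)%:E * last_sum + (G / N%:R)%:E * last_sum)%E.
  rewrite muleA -EFinM -ge0_muleDl ?lee_fin ?divr_ge0//.
  by congr (_%:E * _)%E; rewrite /G; ring.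
apply: leeD; apply: le_trans cT.
  pose dil (h : d.+1.-tuple (freq S)) :=
    snoc (init_tuple h) (tnth h ord_max *+ #|gen S|).
  rewrite (@reindex_esum _ _ _ [set h | tnth h ord_max != 0] _ dil).
    apply: le_esum => h /= hn0; rewrite lee_fin /F.
    apply: (@le_trans _ _ (w (dil h) `^ e * G)).
      rewrite ler_wpM2l ?powR_ge0// /G -[leRHS]sumr_const.
      by apply: ler_sum => g _; rewrite lern1; case: in_dual.
    rewrite mulrC -mulrA ler_wpM2l// -{2}[h]snoc_init.
    exact: coef_weight_dilate.
  split=> [h /= hn0|h h' _ _|h [/= hn0 [m hm]]].
  - split; rewrite /M /= /dil tnth_snoc_max; first exact: mulrn_card_gen_neq0.
    by exists (tnth h ord_max).
  - move=> dil_eq; have [init_eq /(mul_card_gen_inj HS) last_eq] := snoc_inj dil_eq.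
    by rewrite -(snoc_init h) -(snoc_init h') init_eq last_eq.
  - exists (snoc (init_tuple h) m) => /=.
      by rewrite tnth_snoc_max; apply: contraNneq hn0 => m0; rewrite hm m0 mul0rn.
    by rewrite /dil init_snoc tnth_snoc_max -hm snoc_init.
apply: esum_subset_le => [h|h|h [/= hn0 hM]|h []//].
- by rewrite lee_fin.
- by rewrite lee_fin mulr_ge0 ?powR_ge0// divr_ge0.
- rewrite lee_fin /F -{2}[h]snoc_init (count_in_dual HS) 1?mulrC// => m hm.
  by apply: hM; exists m.
Qed.

(** One greedy step: some generator, hence the chosen one, does at most as
    badly as the average over G. *)
Lemma greedy_step (g : gen S) :
  (forall g', dual_sum phi gamma r p (snoc z g) <= dual_sum phi gamma r p (snoc z g'))%E ->
  (dual_sum phi gamma r p (snoc z g) `^ lambda^-1 <=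
   dual_sum phi gamma r p z `^ lambda^-1 + (2 / N%:R)%:E * last_sum)%E.
Proof.
move=> gmin.
have [g' g'le] :=
  exists_le_average (card_gen_gt0 HS) last_dual_sum_ge0 sum_last_dual_sum.
apply: (@le_trans _ _ (dual_sum phi gamma r p (snoc z g') `^ lambda^-1)%E).
  apply: le_poweR => //.
  - by case/andP: lV01 => /ltW.
  - exact: dual_sum_ge0.
by apply: le_trans (dual_sum_snoc g') _; rewrite leeD2l.
Qed.

End Step.

(** The right-hand side of the error bound without constant and exponent, the
    sum over supports being merged into one over frequencies. *)
Definition full_sum d : \bar R :=
  \esum_(h in [set h : d.-tuple (freq S) | h != zero_freq S d]) (w h `^ e)%:E.

Lemma full_sumS d : full_sum d.+1 = (full_sum d + last_sum d)%E.
Proof.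
rewrite /full_sum esum_snoc => [|h]; last by rewrite lee_fin powR_ge0.
under eq_esum do rewrite coef_weight_snoc0.
congr (_ + _)%E.
  congr (\esum_(h in _) _)%E; apply/seteqP; split=> t /=; by rewrite snoc_zero_freq.
congr (\esum_(h in _) _)%E; apply/seteqP; split=> [h /= []//|h /= hn0].
split=> //.
by apply: contraNneq hn0 => ->; rewrite tnth_mktuple.
Qed.

Lemma greedy_bound (s : nat) (z : nat -> gen S) :
  (forall d g, (d < s)%N ->
     dual_sum phi gamma r p (snoc [tuple z i | i < d] (z d)) <=
     dual_sum phi gamma r p (snoc [tuple z i | i < d] g))%E ->
  (dual_sum phi gamma r p [tuple z i | i < s] `^ lambda^-1 <=
   (2 / N%:R)%:E * full_sum s)%E.
Proof.
elim: s => [|s IH] zmin.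
  rewrite /dual_sum esum1 => [|h [/= /eqP[]]]; last by rewrite [h]tuple0 [RHS]tuple0.
  rewrite poweR0r ?mule_ge0 ?lee_fin ?divr_ge0//; last first.
    by rewrite gt_eqF// invr_gt0.
  by apply: esum_ge0 => h _; rewrite lee_fin powR_ge0.
have -> : [tuple z i | i < s.+1] = snoc [tuple z i | i < s] (z s).
  apply: eq_from_tnth => i; rewrite tnth_mktuple.
  case: (unliftP ord_max i) => [j|] ->; last by rewrite tnth_snoc_max.
  by rewrite lift_max_widen tnth_snoc_widen tnth_mktuple.
apply: le_trans (greedy_step (zmin s ^~ (ltnSn s))) _.
rewrite full_sumS ge0_muleDr; first by rewrite leeD2r// IH// => d g /ltnW/zmin.
  by apply: esum_ge0 => h _; rewrite lee_fin powR_ge0.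
by apply: esum_ge0 => h _; rewrite lee_fin powR_ge0.
Qed.

End GreedyStep.

(** * The component-by-component construction *)


Lemma setting_character_rule (R : realType) (alpha : R) (S : qmc_rule R) :
  qmc_setting alpha S -> exists phi, @character_rule R S phi.
Proof.
case=> [N prN|b m n P prb irrP sP nm].
  by exists (@fourier1 R); exact: lattice_character_rule.
exists (wal b); apply: polynomial_character_rule => //.
by rewrite sP /=; case: nm => [->|[a a1 [_ ->]]]//; rewrite leq_pmull.
Qed.

Section ComponentByComponent.
Variables (R : realType) (S : qmc_rule R).
Variables (p : \bar R) (gamma : {fset nat} -> R) (r : freq S -> R).

Lemma extend_snoc s (z : s.-tuple (gen S)) (g0 : gen S) d g : (d <= s)%N ->
  extend z d g = snoc [tuple nth g0 z i | i < d] g.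
Proof.
move=> ds; apply/val_inj => /=; congr (rcons _ g); apply: eq_map => i.
by apply: set_nth_default; rewrite size_tuple (leq_trans (ltn_ord i)).
Qed.

(** A vector obtained greedily up to s is extended by a minimiser; the earlier
    choices, depending only on earlier components, stay valid. *)
Lemma component_by_component_exists s : (0 < #|gen S|)%N ->
  exists z : s.-tuple (gen S), component_by_component p gamma r z.
Proof.
move=> /card_gt0P[g0 _]; elim: s => [|s [z zP]].
  by exists [tuple]; case.
have [g _ gmin] := Order.TotalTheory.arg_minP (P := xpredT)
  (fun g => worst_case_error p gamma r (extend z s g)) (erefl true : xpredT g0).
have prefix_eq d : (d <= s)%N ->
    [tuple nth g0 (snoc z g) i | i < d] = [tuple nth g0 z i | i < d].
  move=> ds; apply: eq_from_tnth => i; rewrite !tnth_mktuple /= nth_rcons.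
  by rewrite size_tuple (leq_trans (ltn_ord i) ds).
exists (snoc z g) => d g'.
have ds : (d <= s)%N by rewrite -ltnS.
rewrite !(extend_snoc _ g0) ?(leqW ds)// prefix_eq// -!(extend_snoc _ g0 _ ds).
have [lt_ds|ge_ds] := ltnP d s.
  have -> : tnth (snoc z g) d = tnth z (Ordinal lt_ds).
    rewrite -(tnth_snoc_widen z g (Ordinal lt_ds)); congr tnth; exact/val_inj.
  exact: (zP (Ordinal lt_ds)).
have dE : d = ord_max by apply/val_inj/eqP; rewrite eqn_leq ds.
by rewrite dE tnth_snoc_max; exact: gmin.
Qed.

Hypotheses (gamma0 : forall u, 0 <= gamma u) (r0 : forall h, 0 < r h).
Hypothesis p1 : (1 < p)%E.
Variable lambda : R.
Hypothesis lambda0 : 0 < lambda.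
Local Notation q := (conj_exponent p).
Local Notation w := (@coef_weight R S gamma r).

Lemma coef_weight_powR d (h : d.-tuple (freq S)) :
  w h `^ (q / lambda) =
  gamma (labels (supp h)) `^ (q / (2 * lambda)) * decay_prod r h `^ (- (q / lambda)).
Proof.
have D0 := decay_prod_gt0 r0 h.
rewrite /coef_weight powRM ?powR_ge0 ?invr_ge0 ?(ltW D0)//; congr (_ * _).
  by rewrite -powRrM; congr (_ `^ _); field; rewrite gt_eqF.
by rewrite powRN -powR_inv1 ?(ltW D0)// powRAC powR_inv1 ?powR_ge0.
Qed.

(** Grouping the non-zero frequencies by their support. *)
Lemma full_sum_le_error_bound s :
  (((2 / (npoints S)%:R)%:E * full_sum gamma r p lambda s) `^ (lambda / q) <=
   error_bound gamma r q lambda s)%E.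
Proof.
have q0 := conj_exponent_gt0 p1.
apply: le_poweR.
- by rewrite divr_ge0// ltW.
- rewrite mule_ge0 ?lee_fin ?divr_ge0//.
  by apply: esum_ge0 => h _; rewrite lee_fin powR_ge0.
rewrite lee_wpmul2l ?lee_fin ?divr_ge0//.
apply: esum_le_fsubsums => A A0.
rewrite big_seq (partition_big (fun h => supp h) (fun u => u != finset.set0)) /=.
  apply: lee_sum => u u0; rewrite sumEFin.
  rewrite (eq_bigr (fun h => gamma (labels u) `^ (q / (2 * lambda)) *
    decay_prod r h `^ (- (q / lambda)))) => [|h /andP[_ /eqP <-]]; last first.
    exact: coef_weight_powR.
  rewrite -mulr_sumr EFinM lee_wpmul2l ?lee_fin ?powR_ge0//.
  rewrite big_fset_condE -sumEFin; apply: fsubsum_le_esum => h.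
    by rewrite lee_fin powR_ge0.
  by rewrite !inE => /and3P[_ _ /eqP].
move=> h hA; apply: contraNneq (A0 h hA) => h0.
apply/zero_freqP => j; apply/eqP/negPn/negP => hj.
have : j \in supp h by rewrite inE.
by rewrite h0 finset.in_set0.
Qed.

End ComponentByComponent.

Theorem theorem3 (R : realType) (p : \bar R) (alpha lambda : R)
    (S : qmc_rule R) (smoothness : set R) (r : R -> freq S -> R)
    (gamma : {fset nat} -> R) (s : nat) :
  (1 < p)%E ->
  qmc_setting alpha S ->
  (forall a, smoothness a -> 0 < a) ->
  smoothness alpha ->
  (forall u, 0 <= gamma u) ->
  (forall a, smoothness a -> forall h, 0 < r a h) ->
  (forall h, h != 0 ->
     (npoints S)%:R `^ alpha * r alpha h <= r alpha (h *+ #|gen S|)) ->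
  (forall a, smoothness a -> 1 < a ->
     (\esum_(h in [set h | h != 0%R]) ((r a h)^-1)%:E < +oo)%E) ->
  1 <= lambda < alpha * conj_exponent p ->
  (0 < s)%N ->
  (exists z : s.-tuple (gen S),
     component_by_component p gamma (r alpha) z) /\
  (forall z : s.-tuple (gen S),
     component_by_component p gamma (r alpha) z ->
     (worst_case_error p gamma (r alpha) z
      <= error_bound gamma (r alpha) (conj_exponent p) lambda s)%E).
Proof.
move=> p1 /setting_character_rule[phi HS] _ sm_alpha gamma0 r0 growth _.
move=> /andP[lambda1 lambda_lt] _.
have G0 := card_gen_gt0 HS; have [g0 _] := card_gt0P G0.
have q0 := conj_exponent_gt0 p1.
have r0' := r0 _ sm_alpha.
have l0 : 0 < lambda by exact: lt_le_trans ltr01 lambda1.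
split=> [|z zP]; first exact: component_by_component_exists.
have W_E d (y : d.-tuple (gen S)) := worst_case_errorE HS gamma0 r0' p1 y.
have dual0 d (y : d.-tuple (gen S)) := dual_sum_ge0 phi gamma (r alpha) p y.
rewrite W_E; apply: le_trans _ (full_sum_le_error_bound gamma r0' p1 l0 s).
have qV : (conj_exponent p)^-1 = lambda^-1 * (lambda / conj_exponent p).
  by rewrite mulrA mulVf ?mul1r// gt_eqF.
rewrite [in leLHS]qV (poweRrM _ lambda^-1); apply: le_poweR; [by rewrite divr_ge0// ltW|exact: poweR_ge0|].
have zE : z = [tuple nth g0 z i | i < s].
  by apply: eq_from_tnth => i; rewrite tnth_mktuple (tnth_nth g0).
rewrite {1}zE; apply: (greedy_bound (z := nth g0 z) HS r0' p1 growth lambda1 lambda_lt).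
move=> d g ds.
rewrite -[leLHS](poweRVK q0 (dual0 _ _)) -[leRHS](poweRVK q0 (dual0 _ _)).
apply: le_poweR; [exact: ltW|exact: poweR_ge0|].
rewrite -!W_E -!(extend_snoc z g0 _ (ltnW ds)).
have := zP (Ordinal ds) g; rewrite (tnth_nth g0).
exact.
Qed.
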